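(* Let $K$ be an infinite field, $\mu=(0,1,\dots,n-1)\in\mathbb Z^n$, and $\lambda=(\lambda_1,\dots,\lambda_n)$ a partition with $\lambda_1=m$ and $\lambda_n\ge n$. Then the reduction number of the specialized Ferrers ideal $\overline I_{\lambda-\mu}$ is $$r(\overline I_{\lambda-\mu})=\min\left\{n-1,\ \left\lfloor\frac{\lambda_i+i}{2}\right\rfloor-1\ :\ 2\le i\le n\right\}.$$
   Context: The specialized Ferrers ideal is $\overline I_{\lambda-\mu}=(x_ix_j:1\le i\le n,\ \mu_i<j\le\lambda_i)\subset K[x_1,\dots,x_m]$. An ideal $J\subset I$ is a reduction of $I$ if $I^{r+1}=JI^r$ for some $r\ge0$; the least such $r$ is $r_J(I)$. A reduction is minimal if no strictly smaller ideal is a reduction of $I$. The reduction number is $r(I)=\min\{r_J(I): J\text{ a minimal reduction of }I\}$. *)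

(* Defs.v *)
From HB Require Import structures.
From mathcomp Require Import all_boot all_order all_algebra.
From mathcomp Require Import mpoly.
Set Implicit Arguments. Unset Strict Implicit. Unset Printing Implicit Defensive.
Import GRing.Theory.
Local Open Scope ring_scope.

Section Ideals.
Variable R : comNzRingType.

Definition is_ideal (I : R -> Prop) : Prop :=
  [/\ I 0, (forall x y, I x -> I y -> I (x + y)) & (forall a x, I x -> I (a * x))].

Definition ideal_sub (I J : R -> Prop) : Prop := forall x, I x -> J x.
Definition ideal_eq (I J : R -> Prop) : Prop := forall x, I x <-> J x.

Inductive ideal_gen (S : R -> Prop) : R -> Prop :=
  | gen_zero : ideal_gen S 0
  | gen_base x : S x -> ideal_gen S x
  | gen_add x y : ideal_gen S x -> ideal_gen S y -> ideal_gen S (x + y)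
  | gen_mul a x : ideal_gen S x -> ideal_gen S (a * x).

Definition ideal_mul (I J : R -> Prop) : R -> Prop :=
  ideal_gen (fun z => exists x y, [/\ I x, J y & z = x * y]).

Fixpoint ideal_pow (I : R -> Prop) (r : nat) : R -> Prop :=
  match r with
  | 0%N => fun _ => True
  | r'.+1 => ideal_mul I (ideal_pow I r')
  end.

Definition reduces_at (J I : R -> Prop) (r : nat) : Prop :=
  ideal_eq (ideal_pow I r.+1) (ideal_mul J (ideal_pow I r)).

Definition is_reduction (J I : R -> Prop) : Prop :=
  [/\ is_ideal J, ideal_sub J I & exists r, reduces_at J I r].

Definition reduction_number_wrt (J I : R -> Prop) (r : nat) : Prop :=
  reduces_at J I r /\ forall s, reduces_at J I s -> (r <= s)%N.

Definition is_minimal_reduction (J I : R -> Prop) : Prop :=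
  is_reduction J I /\
  forall J', is_ideal J' -> ideal_sub J' J -> is_reduction J' I -> ideal_sub J J'.

Definition reduction_number (I : R -> Prop) (r : nat) : Prop :=
  (exists J, is_minimal_reduction J I /\ reduction_number_wrt J I r) /\
  forall J s, is_minimal_reduction J I -> reduction_number_wrt J I s -> (r <= s)%N.

End Ideals.

(* Specialized Ferrers ideal for mu = (0,1,...,n-1):
   generated by x_i x_j with 1 <= i <= n, mu_i = i-1 < j <= lam i.
   Variable x_k (1 <= k <= m) is 'X_(k-1) with index in 'I_m. *)
Definition spec_ferrers_ideal (K : comNzRingType) (m n : nat) (lam : nat -> nat)
  : {mpoly K[m]} -> Prop :=
  ideal_gen (fun p => exists (a b : 'I_m),
     [/\ (a < n)%N, (a <= b)%N, (b < lam a.+1)%N & p = 'X_a * 'X_b]).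

(* Main.v *)
(* Let V be the span of the generators and A = K[V] the fibre ring at the origin, a
   domain of dimension m.  Order the boxes [i, j] of the tableau by inclusion: products
   of nested boxes form a basis of A, and the rank of a box is its length j - i.  The
   sums w_d = sum_i x_i x_(i+d) over the boxes of rank d play the role of the rank
   parameters of a graded poset.  Modulo w_0, ..., w_(m-1), every monomial straightens to
   a combination of "turn chains", i.e. strictly nested chains of boxes whose row and
   column indices are all distinct and whose rows are > 1.  Counting nested chains shows
   that the Hilbert series of A is sum_j (number of turn chains of length j) t^j divided by
   (1 - t)^m, and the longest turn chain has the length r of the formula.

   Lower bound: the leading forms of a minimal reduction J span a space of dimension at
   most m (otherwise Noether normalisation yields a smaller reduction), and if V^(s+1) lies
   in J V^s with s < r, then a generic member of the pencil through J and the w_d generates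
   V^r with fewer than dim V^r products.

   Upper bound: J0 = (w_0, ..., w_(m-1)) satisfies I^(r+1) = J0 I^r.  It is a minimal
   reduction although the polynomial ring is not local: if J' is a reduction strictly
   contained in J0, choose a point phi (with values in a residue field) of the support of
   J0 / J'.  Near phi, J0 is generated by as many elements as the analytic spread of I at
   phi, because all but the w_d of small rank only involve the first rows; hence J' = J0
   near phi, a contradiction. *)
Require Import Defs.
From HB Require Import structures.
From mathcomp Require Import all_boot all_order all_algebra.
From mathcomp Require Import mpoly.
From mathcomp Require Import zify ring.
From mathcomp Require boolp classical_sets.
Set Implicit Arguments. Unset Strict Implicit. Unset Printing Implicit Defensive.
Import GRing.Theory.
Local Open Scope ring_scope.

(** * Linear spans of finite families in a commutative algebra *)

Section LinearSpan.
Variables (F : fieldType) (A : comAlgType F).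
Implicit Types (s t v : seq A) (x y : A).

(** The ambient algebra will be a polynomial ring, so spans are predicates on finite lists;
    [lspan_coord] gives coordinates when matrices enter. *)
Inductive lspan s : A -> Prop :=
  | lspan0 : lspan s 0
  | lspan_cons c x y : x \in s -> lspan s y -> lspan s (c *: x + y).

Lemma lspan_mem s x : x \in s -> lspan s x.
Proof. by move=> xs; rewrite -[x]addr0 -[x]scale1r; apply: lspan_cons => //; apply: lspan0. Qed.

Lemma lspanD s x y : lspan s x -> lspan s y -> lspan s (x + y).
Proof.
move=> sx sy; elim: sx => [|c z w zs _ IH]; first by rewrite add0r.
by rewrite -addrA; apply: lspan_cons.
Qed.

Lemma lspanZ s c x : lspan s x -> lspan s (c *: x).
Proof.
elim=> [|d z w zs _ IH]; first by rewrite scaler0; apply: lspan0.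
by rewrite scalerDr scalerA; apply: lspan_cons.
Qed.

Lemma lspanN s x : lspan s x -> lspan s (- x).
Proof. by rewrite -scaleN1r; apply: lspanZ. Qed.

Lemma lspanB s x y : lspan s x -> lspan s y -> lspan s (x - y).
Proof. by move=> sx sy; apply: lspanD => //; apply: lspanN. Qed.

Lemma lspan_sum s (I : eqType) (r : seq I) (P : pred I) (E : I -> A) :
  (forall i, i \in r -> P i -> lspan s (E i)) -> lspan s (\sum_(i <- r | P i) E i).
Proof.
move=> sE; rewrite big_seq_cond; elim/big_rec: _ => [|i x /andP[ir Pi] sx]; first exact: lspan0.
by apply: lspanD => //; apply: sE.
Qed.

Lemma lspan_trans s t x : {in s, forall y, lspan t y} -> lspan s x -> lspan t x.
Proof.
move=> st; elim=> [|c y z ys _ IH]; first exact: lspan0.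
by apply: lspanD => //; apply/lspanZ/st.
Qed.

Lemma lspan_subset s t x : {subset s <= t} -> lspan s x -> lspan t x.
Proof. by move=> st; apply: lspan_trans => y /st; apply: lspan_mem. Qed.

Lemma lspan_coord s x : lspan s x -> exists c : nat -> F, x = \sum_(i < size s) c i *: s`_i.
Proof.
elim=> [|d y z ys _ [c ->]].
  by exists (fun _ => 0); rewrite big1 // => i _; rewrite scale0r.
exists (fun i => (if i == index y s then d else 0) + c i).
under [RHS]eq_bigr do rewrite scalerDl.
rewrite big_split /=; congr (_ + _).
have lt : (index y s < size s)%N by rewrite index_mem.
rewrite (bigD1 (Ordinal lt)) //= eqxx nth_index // big1 ?addr0 // => i.
by rewrite -val_eqE /= => /negPf->; rewrite scale0r.
Qed.

Definition prods s t : seq A := [seq x * y | x <- s, y <- t].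

Lemma mem_prods s t x y : x \in s -> y \in t -> x * y \in prods s t.
Proof. by move=> xs yt; apply/allpairsP; exists (x, y). Qed.

Lemma prodsP s t z : z \in prods s t -> exists x y, [/\ x \in s, y \in t & z = x * y].
Proof. by case/allpairsP=> -[x y] [/=]; exists x, y. Qed.

Lemma lspanM s t x y : lspan s x -> lspan t y -> lspan (prods s t) (x * y).
Proof.
elim=> [|c z w zs _ IH] ty; first by rewrite mul0r; apply: lspan0.
rewrite mulrDl -scalerAl; apply: lspanD; last exact: IH.
apply: lspanZ; elim: ty => [|d u u' ut _ IHu]; first by rewrite mulr0; apply: lspan0.
by rewrite mulrDr -scalerAr; apply: lspan_cons => //; apply: mem_prods.
Qed.

Lemma lspan_prods_mono s s' t t' x :
  {in s, forall y, lspan s' y} -> {in t, forall y, lspan t' y} ->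
  lspan (prods s t) x -> lspan (prods s' t') x.
Proof.
move=> ss tt; apply: lspan_trans => _ /prodsP[y [z [ys zt ->]]].
by apply: lspanM; [apply: ss | apply: tt].
Qed.

Fixpoint pows v N : seq A := if N is N'.+1 then prods v (pows v N') else [:: 1].

Lemma pows_mulr v a b x y : x \in pows v a -> y \in pows v b -> x * y \in pows v (a + b).
Proof.
elim: a x => [|a IH] x; first by rewrite /= inE => /eqP->; rewrite mul1r.
case/prodsP=> z [w [zv wp ->]] yp; rewrite -mulrA addSn.
by apply: mem_prods => //; apply: IH.
Qed.

Lemma pows_split v a b x : x \in pows v (a + b) ->
  exists y z, [/\ y \in pows v a, z \in pows v b & x = y * z].
Proof.
elim: a x => [|a IH] x /=; first by exists 1, x; rewrite mem_head mul1r.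
case/prodsP=> u [w [uv /IH[y [z [yp zp ->]]] ->]].
by exists (u * y), z; rewrite mulrA mem_prods.
Qed.

(** Splitting off N - r factors leaves a product of r + 1 elements, to which the hypothesis
    applies. *)
Lemma pows_stab v w r N : {in pows v r.+1, forall x, lspan (prods w (pows v r)) x} ->
  (r <= N)%N -> {in pows v N.+1, forall x, lspan (prods w (pows v N)) x}.
Proof.
move=> H /subnK<-; move: (N - r)%N => k x.
rewrite -addnS => /pows_split[y [z [yp /H zr ->]]].
apply: (lspan_trans _ (lspanM (lspan_mem (mem_head y [::])) zr)).
move=> _ /prodsP[_ [_ [/[!inE]/eqP-> /prodsP[a [b [aw bp ->]]] ->]]].
by rewrite mulrCA; apply/lspan_mem/mem_prods => //; apply: pows_mulr.
Qed.

Lemma lspan_dep (s t : seq A) : (size t < size s)%N -> {in s, forall x, lspan t x} ->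
  exists c : nat -> F, \sum_(i < size s) c i *: s`_i = 0 /\
    exists2 i, (i < size s)%N & c i != 0.
Proof.
move=> lt st.
have /fin_all_exists[c cE] (i : 'I_(size s)) :
    exists c : nat -> F, s`_i = \sum_(j < size t) c j *: t`_j.
  by apply/lspan_coord/st/mem_nth.
pose M : 'M[F]_(size s, size t) := \matrix_(i, j) c i j.
have : kermx M != 0.
  rewrite -mxrank_eq0 mxrank_ker -lt0n subn_gt0.
  by apply: leq_ltn_trans lt; apply: rank_leq_col.
case/rowV0Pn=> u /sub_kermxP uM u0.
pose d k := if insub k is Some i then u 0 (i : 'I_(size s)) else 0.
have dE (j : 'I_(size s)) : d j = u 0 j by rewrite /d valK.
exists d; split.
  under eq_bigr do rewrite dE cE scaler_sumr.
  rewrite exchange_big big1 //= => j _.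
  under eq_bigr do rewrite scalerA.
  rewrite -scaler_suml; move/matrixP/(_ 0 j): uM; rewrite !mxE.
  by under eq_bigr do rewrite mxE; move->; rewrite scale0r.
have [j uj] : exists j, u 0 j != 0.
  apply/existsP; apply: contraNT u0; rewrite negb_exists => /forallP u0.
  by apply/eqP/rowP => j; rewrite mxE; apply/eqP; rewrite -[_ == _]negbK.
by exists j; rewrite ?dE.
Qed.

(* The identities e = L p and q = Q e give L (p + t q) = (1 + t L Q) e, and the
   matrix on the right is invertible unless t is a root of its determinant. *)
Lemma lspan_pencil (e p q : seq A) :
  size q = size p -> {in e, forall x, lspan p x} -> {in q, forall x, lspan e x} ->
  exists P : {poly F}, P.[0] = 1 /\ forall t : F, P.[t] != 0 ->
    {in e, forall x, lspan [seq z.1 + t *: z.2 | z <- zip p q] x}.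
Proof.
move=> sq ep qe.
have /fin_all_exists[a aE] (i : 'I_(size e)) :
    exists c : nat -> F, e`_i = \sum_(j < size p) c j *: p`_j.
  by apply/lspan_coord/ep/mem_nth.
have /fin_all_exists[b bE] (i : 'I_(size p)) :
    exists c : nat -> F, q`_i = \sum_(j < size e) c j *: e`_j.
  by apply/lspan_coord/qe/mem_nth; rewrite sq.
pose La : 'M[F]_(size e, size p) := \matrix_(i, j) a i j.
pose Qb : 'M[F]_(size p, size e) := \matrix_(i, j) b i j.
pose B := La *m Qb.
pose P : {poly F} := \det (1%:M + 'X *: map_mx polyC B).
have PE (t : F) : P.[t] = \det (1%:M + t *: B).
  rewrite /P -horner_evalE -det_map_mx; congr (\det _).
  apply/matrixP => i j; rewrite !mxE /= horner_evalE hornerD hornerM hornerX hornerC.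
  by congr (_ + _); rewrite hornerMn hornerC.
exists P; split=> [|t Pt x xe]; first by rewrite PE scale0r addr0 det1.
set M := 1%:M + t *: B in PE.
have Mu : M \in unitmx by rewrite unitmxE unitfE -PE.
set r := [seq _ | _ <- _].
have sr : size r = size p by rewrite size_map size_zip sq minnn.
have rE (i : 'I_(size p)) : r`_i = p`_i + t *: q`_i.
  by rewrite (nth_map (0, 0)) ?nth_zip ?size_zip ?sq ?minnn.
have key (i : 'I_(size e)) : \sum_(k < size e) M i k *: e`_k = \sum_(j < size p) a i j *: r`_j.
  under [RHS]eq_bigr do rewrite rE scalerDr.
  rewrite big_split -aE /=.
  under eq_bigr do rewrite mxE scalerDl.
  rewrite big_split /=; congr (_ + _).
    rewrite (bigD1 i) //= mxE eqxx scale1r big1 ?addr0 // => k ki.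
    by rewrite mxE eq_sym (negPf ki) scale0r.
  under [RHS]eq_bigr do rewrite bE scalerA mulrC -scalerA scaler_sumr.
  rewrite -scaler_sumr exchange_big scaler_sumr; apply: eq_bigr => k _ /=.
  rewrite mxE -scalerA mxE scaler_suml; congr (_ *: _); apply: eq_bigr => j _.
  by rewrite !mxE scalerA.
have -> : x = \sum_(i < size e) (invmx M) (Ordinal (etrans (index_mem x e) xe)) i *:
               \sum_(j < size p) a i j *: r`_j.
  set o := Ordinal _; under eq_bigr do rewrite -key scaler_sumr.
  rewrite exchange_big /= (bigD1 o) //= [X in _ + X]big1 ?addr0 => [|k ko].
    under eq_bigr do rewrite scalerA.
    rewrite -scaler_suml; have /matrixP/(_ o o) := mulVmx Mu.
    by rewrite !mxE eqxx => ->; rewrite scale1r nth_index.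
  under eq_bigr do rewrite scalerA.
  rewrite -scaler_suml; have /matrixP/(_ o k) := mulVmx Mu.
  by rewrite !mxE eq_sym (negPf ko) => ->; rewrite scale0r.
apply: lspan_sum => i _ _; apply/lspanZ/lspan_sum => j _ _; apply/lspanZ/lspan_mem.
by apply: mem_nth; rewrite sr.
Qed.

End LinearSpan.

(** * Multisets and filtered generation *)

(* Multisets of size D in {0, ..., k-1}, as nonincreasing sequences. *)
Fixpoint multisets (k D : nat) : seq (seq nat) :=
  match k with
  | 0 => if D is 0 then [:: [::]] else [::]
  | k'.+1 => (fix aux D := if D is D'.+1 then multisets k' D'.+1 ++ map (cons k') (aux D')
                           else [:: [::]]) D
  end.

Definition nmultisets k D := size (multisets k D).

Lemma multisetsS k D : multisets k.+1 D.+1 = multisets k D.+1 ++ map (cons k) (multisets k.+1 D).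
Proof. by []. Qed.

Lemma multisets0 k : multisets k 0 = [:: [::]]. Proof. by case: k. Qed.

Lemma nmultisetsS k D : nmultisets k.+1 D.+1 = (nmultisets k D.+1 + nmultisets k.+1 D)%N.
Proof. by rewrite /nmultisets multisetsS size_cat size_map. Qed.

Lemma nmultisetsx0 k : nmultisets k 0 = 1%N. Proof. by rewrite /nmultisets multisets0. Qed.

Lemma nmultisets0S D : nmultisets 0 D.+1 = 0%N. Proof. by []. Qed.

Lemma multisetsP k D l :
  reflect [/\ sorted geq l, size l = D & all (gtn k) l] (l \in multisets k D).
Proof.
apply: (iffP idP).
  elim: k D l => [|k IHk] D.
    by case: D => [|D] l //; rewrite inE => /eqP->.
  elim: D => [|D IHD] l; first by rewrite inE => /eqP->.
  rewrite multisetsS mem_cat => /orP[/IHk[sl zl al]|/mapP[l' /IHD[sl zl al] ->]].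
    by split=> //; apply: sub_all al => i /=; lia.
  split=> /=; [|by rewrite zl|by rewrite ltnSn al].
  rewrite path_sortedE ?sl ?andbT; last by move=> a b c /= ? ?; lia.
  by apply: sub_all al => i /=; lia.
case; elim: k D l => [|k IHk] D l.
  by case: l => [|i l] //= _ <- _; rewrite inE.
elim: D l => [|D IHD] [|i l] //= sl [sz] /andP[ik al].
rewrite mem_cat; case: (ltnP i k) => ki.
  rewrite (IHk D.+1) //= ?sz // ki /=.
  move: sl; rewrite path_sortedE; last by move=> a b c /= ? ?; lia.
  by case/andP=> + _; apply: sub_all => j /=; lia.
have -> : i = k by lia.
by rewrite map_f ?orbT //; apply: IHD => //; apply: path_sorted sl.
Qed.

Lemma sort_multisets k D l : size l = D -> all (gtn k) l -> sort geq l \in multisets k D.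
Proof.
move=> sl al; apply/multisetsP; split; last 1 first.
- by rewrite all_sort.
- by apply: sort_sorted => a b /=; lia.
- by rewrite size_sort.
Qed.

Lemma nmultisets_leq k D D' : (0 < k)%N -> (D <= D')%N -> (nmultisets k D <= nmultisets k D')%N.
Proof.
case: k => // k _ /subnK<-; elim: (D' - D)%N => // d; rewrite addSn nmultisetsS; lia.
Qed.

(** For k > 0, [nmultisets k D] is the binomial coefficient of D + k - 1 over D; this is its
    absorption identity. *)
Lemma nmultisets_ratio k D : (k * nmultisets k.+1 D = (D + k) * nmultisets k D)%N.
Proof.
elim: k D => [|k IHk] D; first by case: D => [|D]; rewrite ?mul0n ?muln0 // addn0.
elim: D => [|D IHD]; first by rewrite !nmultisetsx0.
rewrite nmultisetsS mulnDr IHD; have := IHk D.+1; rewrite nmultisetsS; nia.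
Qed.

Lemma nmultisets_dominates k c : exists D, (c * nmultisets k D < nmultisets k.+1 D)%N.
Proof.
case: k => [|k]; first by exists 1%N; rewrite muln0.
exists (c * k.+1)%N; have := nmultisets_ratio k.+1 (c * k.+1).
have : (0 < nmultisets k.+1 (c * k.+1))%N.
  by apply: leq_trans (nmultisets_leq _ (leq0n _)) => //; rewrite nmultisetsx0.
nia.
Qed.

Lemma nmultisets_leq_var k k' D : (k <= k')%N -> (nmultisets k D <= nmultisets k' D)%N.
Proof.
move=> /subnK<-; elim: (k' - k)%N => // d IH; apply: leq_trans IH _.
by rewrite addSn; case: D => [|D]; rewrite ?nmultisetsx0 // nmultisetsS leq_addr.
Qed.

(** By [nmultisets_ratio], each further variable costs a factor (2D + k) / (D + k) <= 2. *)
Lemma nmultisets_double k D : (nmultisets k (D + D) <= 2 ^ k * nmultisets k D)%N.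
Proof.
elim: k => [|[|k] IHk]; first by case: D.
  have ms1 n : nmultisets 1 n = 1%N by elim: n => // n IH; rewrite nmultisetsS nmultisets0S IH.
  by rewrite !ms1.
have := nmultisets_ratio k.+1 (D + D); have := nmultisets_ratio k.+1 D; rewrite [(2 ^ k.+2)%N]expnS.
nia.
Qed.

(** The two sides grow like D^(k-1) and D^k; the inequality forces a homogeneous relation among k +
    1 quadrics in k variables. *)
Lemma nmultisets_dominates_double k : exists D, (nmultisets k (D.+1 + D.+1) < nmultisets k.+1 D.+1)%N.
Proof.
have [[|D] lt] := nmultisets_dominates k (2 ^ k); last first.
  by exists D; apply: leq_ltn_trans lt; apply: nmultisets_double.
by move: lt; rewrite !nmultisetsx0; have := expn_gt0 2 k; lia.
Qed.

Section Count.
Variables (F : fieldType) (A : comAlgType F).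
Variables (k : nat) (w : nat -> A) (us ts : nat -> seq A).

Definition monos D : seq A := [seq \prod_(i <- l) w i | l <- multisets k D].

Definition wlist : seq A := [seq w i | i <- iota 0 k].

Lemma wlistP i : (i < k)%N -> w i \in wlist.
Proof. by move=> ik; apply: map_f; rewrite mem_iota. Qed.

Lemma monos_mul D i x : (i < k)%N -> x \in monos D -> w i * x \in monos D.+1.
Proof.
move=> ik /mapP[l /multisetsP[sl zl al] ->].
apply/mapP; exists (sort geq (i :: l)); last first.
  by rewrite (perm_big _ (permEl (perm_sort _ _))) big_cons.
by apply: sort_multisets; rewrite /= ?zl ?ik.
Qed.

(** A term stopped in degree j by an element of [ts j] carries N - j factors [w i]. The length of
    this list is the upper bound in the dimension counts below. *)
Definition filtration N : seq A :=
  flatten [seq prods (monos (N - j)) (ts j) | j <- iota 0 N.+1].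

Lemma size_filtration N :
  size (filtration N) = (\sum_(0 <= j < N.+1) nmultisets k (N - j) * size (ts j))%N.
Proof.
rewrite size_flatten /shape -map_comp sumnE big_map /index_iota subn0.
by apply: eq_bigr => j _; rewrite /= size_allpairs size_map.
Qed.

Lemma lspan_filtration N :
  {in us 0, forall x, lspan (ts 0) x} ->
  (forall M, (M < N)%N -> {in us M.+1, forall x, lspan (prods wlist (us M) ++ ts M.+1) x}) ->
  {in us N, forall x, lspan (filtration N) x}.
Proof.
move=> h0; elim: N => [_|N IH hS] x xN.
  rewrite /filtration /= cats0; apply: lspan_trans (h0 _ xN) => y yt.
  by rewrite -[y]mul1r; apply/lspan_mem/mem_prods; rewrite // /monos multisets0 /= big_nil inE.
have {}IH : {in us N, forall x, lspan (filtration N) x}.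
  by apply: IH => M MN; apply: hS; lia.
apply: lspan_trans (hS _ (ltnSn N) _ xN) => {xN}x /[1!mem_cat]/orP[|xt]; last first.
  apply: lspan_mem; apply/flattenP; exists (prods (monos (N.+1 - N.+1)) (ts N.+1)).
    by apply/mapP; exists N.+1; rewrite // mem_iota; lia.
  by rewrite subnn -[x]mul1r; apply: mem_prods; rewrite // /monos multisets0 /= big_nil inE.
case/prodsP=> a [y [/mapP[i + ->] /IH ys ->]]; rewrite mem_iota => ik.
have := lspanM (lspan_mem (mem_head (w i) [::])) ys; apply: lspan_trans.
move=> _ /prodsP[_ [u [/[!inE]/eqP-> /flattenP[_ /mapP[j + ->]] uz ->]]].
rewrite mem_iota => jN; case/prodsP: uz => z [t [zm tt ->]].
apply: lspan_mem; apply/flattenP; exists (prods (monos (N.+1 - j)) (ts j)).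
  by apply/mapP; exists j; rewrite // mem_iota; lia.
by rewrite mulrA subSn; [apply: mem_prods => //; apply: monos_mul|lia].
Qed.

End Count.

(** * Growth of fibre algebras *)

Section Monomials.
Variables (F : fieldType) (m : nat).

Lemma lspan_monomials_size (e : seq 'X_{1..m}) (t : seq {mpoly F[m]}) :
  uniq e -> {in e, forall a, lspan t 'X_[a]} -> (size e <= size t)%N.
Proof.
move=> ue et; rewrite leqNgt; apply/negP => lt.
have [||c [cs [i ilt /eqP[]]]] := @lspan_dep _ _ [seq 'X_[a] | a <- e] t.
- by rewrite size_map.
- by move=> _ /mapP[a /et ta ->].
rewrite size_map in cs ilt.
move/(congr1 (mcoeff (nth 0%MM e i))): cs; rewrite mcoeff0 raddf_sum /=.
rewrite (bigD1 (Ordinal ilt)) //= mcoeffZ (nth_map 0%MM) // mcoeffX eqxx mulr1.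
rewrite big1 ?addr0 // => j; rewrite -val_eqE /= => ji.
by rewrite mcoeffZ (nth_map 0%MM) // mcoeffX nth_uniq // (negPf ji) mulr0.
Qed.

(* Analytic spread: comparing the growth of both sides in large degrees bounds
   the number of generators of a reduction of the fibre from below. *)
Lemma spread_bound (v w : seq {mpoly F[m]}) (y : nat -> 'X_{1..m}) (k s : nat) :
  (forall i, (i < k)%N -> exists2 a, y i a != 0%N & forall j, (j < i)%N -> y j a = 0%N) ->
  (forall i, (i < k)%N -> lspan v 'X_[y i]) ->
  {in pows v s.+1, forall x, lspan (prods w (pows v s)) x} -> (k <= size w)%N.
Proof.
move=> priv yv red; rewrite leqNgt; apply/negP => lt.
pose c := size (pows v s).
have [N Nlt] := nmultisets_dominates (size w) c.
pose ymon D : seq 'X_{1..m} := [seq (\sum_(i <- l) y i)%MM | l <- multisets k D].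
(* Each [y k'] has a variable absent from all earlier ones, so no sum containing [y k'] equals a sum
   over smaller indices. *)
have uy k' D : (k' <= k)%N -> uniq [seq (\sum_(i <- l) y i)%MM | l <- multisets k' D].
  elim: k' D => [|k' IHk] D k'k; first by case: D.
  elim: D => [|D IHD] //; rewrite multisetsS map_cat cat_uniq IHk ?(ltnW k'k) //=.
  have -> : map (fun l => \sum_(i <- l) y i)%MM (map (cons k') (multisets k'.+1 D)) =
      map (fun a => y k' + a)%MM (map (fun l => \sum_(i <- l) y i)%MM (multisets k'.+1 D)).
    by rewrite -!map_comp; apply: eq_map => l /=; rewrite big_cons.
  rewrite (map_inj_uniq (@addmI _ _)) IHD andbT.
  have [a ya ja] := priv _ k'k.
  apply/hasPn => _ /mapP[b _ ->]; apply/negP.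
  move=> /mapP[l /multisetsP[_ _ al]] /(congr1 (fun b => fun_of_multinom b a)).
  rewrite mnmDE mnm_sumE big_seq big1 => [|i il]; first by move: ya; case: (y k' a).
  by apply: ja; move/allP: al; apply.
have ys D : {in ymon D, forall a, lspan (pows v D) 'X_[a]}.
  move=> _ /mapP[l /multisetsP[_ sl al] ->]; rewrite -sl; elim: l al {sl} => [|i l IHl] /=.
    by rewrite big_nil mpolyX0 => _; apply: lspan_mem; rewrite inE.
  by case/andP=> ik /IHl yl; rewrite big_cons mpolyXD; apply: lspanM => //; apply: yv.
(* Degrees are counted from s: stage 0 is all of V^s and nothing new enters later, so V^(s+N) is
   spanned by monomials of degree N in [w] times V^s. *)
pose us M := pows v (s + M); pose ts M := if M is 0 then pows v s else [::].
have sub := @lspan_filtration _ _ (size w) (nth 0 w) us ts N.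
have le : (nmultisets k (s + N) <= size (filtration (size w) (nth 0%R w) ts N))%N.
  rewrite /nmultisets -(size_map (fun l => \sum_(i <- l) y i)%MM (multisets k (s + N))).
  apply: lspan_monomials_size (uy k (s + N) (leqnn k)) _ => a /ys.
  apply: lspan_trans; apply: sub => [x|M MN x]; rewrite /us.
    by rewrite addn0; apply: lspan_mem.
  rewrite addnS cats0 /wlist map_nth_iota0 // take_size.
  by apply: (pows_stab red); apply: leq_addr.
rewrite size_filtration big_nat_recl //= subn0 big1 ?addn0 in le; last first.
  by move=> i _; rewrite muln0.
rewrite -/c in le.
have := nmultisets_leq_var (s + N) lt; have := @nmultisets_leq (size w).+1 N (s + N) isT (leq_addl _ _).
lia.
Qed.

End Monomials.

(** * Noether normalisation over an infinite field *)

Section InfiniteField.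
Variables (K : fieldType) (Kinf : forall s : seq K, exists x : K, x \notin s).

Lemma nonroot (p : {poly K}) : p != 0 -> exists x, p.[x] != 0.
Proof.
move=> p0; have [s us ss] : exists2 s : seq K, uniq s & size s = size p.
  elim: (size p) => [|n [s us ss]]; first by exists [::].
  by have [x xs] := Kinf s; exists (x :: s); rewrite /= ?xs ?ss.
have : ~~ all (root p) s by apply/negP => /(max_poly_roots p0)/(_ us); rewrite ss ltnn.
by case/allPn=> x _ px; exists x.
Qed.

(** The multiplicities are at most D < B, hence are the base B digits of the sum. This is the
    Kronecker substitution that makes a form univariate. *)
Lemma base_sum_uniq (B k D : nat) : (D < B)%N ->
  uniq [seq (\sum_(i <- l) B ^ i)%N | l <- multisets k D].
Proof.
elim: k D => [|k IHk] D; first by case: D.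
elim: D => [|D IHD] DB //; rewrite multisetsS map_cat cat_uniq IHk //=.
have -> : map (fun l => \sum_(i <- l) B ^ i)%N (map (cons k) (multisets k.+1 D)) =
    map (addn (B ^ k)) (map (fun l => \sum_(i <- l) B ^ i)%N (multisets k.+1 D)).
  by rewrite -!map_comp; apply: eq_map => l /=; rewrite big_cons.
rewrite (map_inj_uniq (@addnI _)) IHD ?andbT; last by lia.
apply/hasPn => _ /mapP[b _ ->]; apply/negP => /mapP[l /multisetsP[_ sl al]] e.
case: k IHk IHD al e => [|k] _ _ al; first by case: l sl al => [|[]].
suff : (\sum_(i <- l) B ^ i <= D.+1 * B ^ k)%N.
  have lt : (D.+1 * B ^ k < B ^ k.+1)%N by rewrite expnS ltn_pmul2r // expn_gt0; lia.
  by move=> le /= e; move: (leq_ltn_trans le lt); rewrite -e ltnNge leq_addr.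
rewrite -sl; elim: l al {sl} => [|i l IHl] /=; first by rewrite big_nil.
case/andP=> ik /IHl le; rewrite big_cons mulSn.
by apply: leq_add le; rewrite leq_exp2l; lia.
Qed.

Variable A : comAlgType K.

(* Noether normalisation, one generator at a time: more than m quadrics in m
   variables satisfy a relation, and a hyperplane of their span avoiding a point
   where the relation does not vanish still defines a reduction of the fibre. *)
Lemma drop_generator (m : nat) (x : nat -> A) (v w : seq A) (s : nat) :
  {in v, forall z, lspan (prods (wlist m x) (wlist m x)) z} ->
  {in w, forall z, lspan v z} ->
  {in pows v s.+1, forall z, lspan (prods w (pows v s)) z} -> (m < size w)%N ->
  exists w' s', [/\ size w' = (size w).-1, {in w', forall z, lspan w z} &
    {in pows v s'.+1, forall z, lspan (prods w' (pows v s')) z}].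
Proof.
move=> vx wv red mw; pose d := size w; pose W i := w`_i.
have [D Dlt] := nmultisets_dominates_double m.
have monw D' l : size l = D' -> all (gtn d) l -> \prod_(i <- l) W i \in pows w D'.
  move=> <- {D'}; elim: l => [|i l IH] /=; first by rewrite big_nil inE.
  by case/andP=> ik /IH ?; rewrite big_cons; apply: mem_prods => //; apply: mem_nth.
have wlW : wlist d W = w by rewrite /wlist map_nth_iota0 // take_size.
have powx N : {in pows w N, forall z, lspan (monos m x (N + N)) z}.
  elim: N => [|N IH] z; first by rewrite /monos multisets0 /= big_nil; apply: lspan_mem.
  case/prodsP=> a [b [/wv aw /IH bx ->]].
  have {}aw := lspan_trans vx aw; have := lspanM aw bx; apply: lspan_trans.
  move=> _ /prodsP[_ [c [/prodsP[_ [_ [/mapP[i + ->] /mapP[j + ->] ->]]] cm ->]]].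
  rewrite !mem_iota addSn addnS => im jm; apply: lspan_mem.
  by rewrite -mulrA; do 2![apply: monos_mul => //].
have [||c [c0 [i0 i0lt ci0]]] := @lspan_dep _ _ (monos d W D.+1) (monos m x (D.+1 + D.+1)).
- rewrite !size_map; apply: leq_trans Dlt _.
  exact: nmultisets_leq_var.
- move=> _ /mapP[l /multisetsP[_ sl al] ->]; apply: powx; exact: monw.
(* Larger than the degree D + 1 of the relation, so that its terms stay apart. *)
pose B := D.+2; pose ix := multisets d D.+1.
pose e i := (\sum_(j <- nth [::] ix i) B ^ j)%N.
rewrite size_map -/ix in c0 i0lt.
(* The factor ['X] makes t, hence every coordinate of the point [a], nonzero. *)
pose P : {poly K} := 'X * \sum_(i < size ix) c i *: 'X^(e i).
have P0 : P != 0.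
  rewrite mulf_neq0 ?polyX_eq0 //; apply: contraNneq ci0 => /(congr1 (coefp (e i0))).
  rewrite /= coef0 coef_sum (bigD1 (Ordinal i0lt)) //= coefZ coefXn eqxx mulr1.
  rewrite big1 ?addr0 => [->//|i]; rewrite -val_eqE /= => ii0; rewrite coefZ coefXn.
  have := nth_uniq 0%N (s := [seq (\sum_(i <- l) B ^ i)%N | l <- ix]).
  move/(_ i0 i); rewrite !size_map !(nth_map [::]) // base_sum_uniq // -/(e i) -/(e i0).
  by move=> -> //; rewrite eq_sym (negPf ii0) mulr0.
have [t] := nonroot P0; rewrite /P hornerM hornerX mulf_eq0 negb_or => /andP[t0 Pt].
pose a j := t ^+ (B ^ j).
have a0 j : a j != 0 by rewrite expf_neq0.
(* The [u j] span the forms vanishing at the point [a]; the normalisation of [z] makes [u 0] zero,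
   which saves one generator. *)
pose z := (a 0%N)^-1 *: W 0%N; pose u j := W j - a j *: z.
have u0 : u 0%N = 0 by rewrite /u /z scalerA mulfV // scale1r subrr.
pose w' := [seq u j | j <- iota 1 d.-1].
have uw' j : (j < d)%N -> lspan w' (u j).
  case: j => [|j] jd; first by rewrite u0; apply: lspan0.
  by apply/lspan_mem/map_f; rewrite mem_iota; lia.
have ww j : (j < d)%N -> lspan w (W j) by move=> jd; apply/lspan_mem/mem_nth.
have zw : lspan w z by apply/lspanZ/ww; rewrite /d; lia.
clearbody z; pose G N := if N is N'.+1 then prods w' (pows w N') else [::].
have prodG l : all (gtn d) l ->
    lspan (G (size l)) (\prod_(j <- l) W j - (\prod_(j <- l) a j) *: z ^+ size l).
  elim: l => [|j l IH] /=; first by rewrite !big_nil scale1r subrr; constructor.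
  case/andP=> jd al; rewrite !big_cons exprS.
  have -> : W j * \prod_(i <- l) W i - (a j * \prod_(i <- l) a i) *: (z * z ^+ size l) =
      u j * \prod_(i <- l) W i +
      a j *: (z * (\prod_(i <- l) W i - (\prod_(i <- l) a i) *: z ^+ size l)).
    rewrite /u mulrBl -scalerAl mulrBr scalerBr -[z * (_ *: _)]scalerAr scalerA.
    by rewrite addrA subrK.
  apply: lspanD; first by apply: lspanM; [exact: uw' | apply/lspan_mem/monw].
  apply: lspanZ; move: (IH al); case: (size l) => [|N] /= GN.
    have : lspan [::] (z * (\prod_(i <- l) W i - (\prod_(i <- l) a i) *: z ^+ 0)).
      by have := lspanM zw GN; apply: lspan_trans => y /prodsP[? [? []]].
    by apply: lspan_subset.
  have := lspanM zw GN; apply: lspan_trans.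
  move=> _ /prodsP[b [_ [bw /prodsP[y [y' [yw yp ->]]] ->]]].
  by rewrite mulrCA; apply/lspan_mem/mem_prods => //; apply: mem_prods.
(* Modulo [w'] each [W j] is [a j *: z], so the relation [c0] becomes its nonzero value at [a] times
   z^(D+1). *)
have zG : lspan (prods w' (pows w D)) (z ^+ D.+1).
  have cP : (\sum_(i < size ix) c i *: 'X^(e i)).[t] =
      \sum_(i < size ix) c i * \prod_(j <- nth [::] ix i) a j.
    rewrite horner_sum; apply: eq_bigr => i _; rewrite hornerZ hornerXn; congr (_ * _).
    by rewrite /e expr_sum.
  rewrite -[z ^+ _]scale1r -(mulVf Pt) -scalerA; apply: lspanZ.
  rewrite cP -[X in lspan _ X]opprK; apply: lspanN; rewrite -[X in lspan _ X]add0r -c0.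
  rewrite scaler_suml -sumrB; apply: lspan_sum => i _ _.
  have /multisetsP[_ sl al] : nth [::] ix i \in ix by apply: mem_nth.
  rewrite (nth_map [::]) // -scalerA -scalerBr; apply: lspanZ.
  by have := prodG _ al; rewrite sl.
have wG : {in pows w D.+1, forall y, lspan (prods w' (pows w D)) y}.
  have ixw N : {in pows w N, forall y, exists l, [/\ all (gtn d) l, size l = N & y = \prod_(j <- l) W j]}.
    elim: N => [|N IH] y; first by rewrite inE => /eqP->; exists [::]; rewrite big_nil.
    case/prodsP=> b [y' [bw /IH[l [al <- ->]] ->]]; exists (index b w :: l).
    by rewrite big_cons /= index_mem bw /W nth_index.
  move=> y /ixw[l [al sl ->]]; rewrite -[\prod_(j <- l) _](subrK ((\prod_(j <- l) a j) *: z ^+ D.+1)).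
  apply: lspanD; last exact: lspanZ.
  by have := prodG _ al; rewrite sl.
exists w', (s + D)%N; split; first by rewrite size_map size_iota.
  move=> _ /mapP[j + ->]; rewrite mem_iota => jd.
  by apply: lspanB; [apply: ww; lia | apply: lspanZ].
have wpow N : {in pows v (s + N), forall y, lspan (prods (pows w N) (pows v s)) y}.
  elim: N => [|N IH] y.
    by rewrite addn0 => yv; rewrite -[y]mul1r; apply/lspan_mem/mem_prods; rewrite ?inE.
  rewrite addnS => /(pows_stab red (leq_addr _ _)); apply: lspan_trans.
  move=> _ /prodsP[b [y' [bw /IH ys ->]]].
  have := lspanM (lspan_mem bw) ys; apply: lspan_trans.
  move=> _ /prodsP[b' [_ [bw' /prodsP[f [g [fw gv ->]]] ->]]].
  by rewrite mulrA; apply/lspan_mem/mem_prods => //; apply: mem_prods.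
have wvp N : {in pows w N, forall y, lspan (pows v N) y}.
  elim: N => [|N IH] y; first exact: lspan_mem.
  by case/prodsP=> b [y' [/wv bw /IH ys ->]]; apply: lspanM.
move=> y; rewrite -addnS => /wpow; apply: lspan_trans => _ /prodsP[f [g [/wG fw gv ->]]].
have := lspanM fw (lspan_mem gv); apply: lspan_trans.
move=> _ /prodsP[_ [g' [/prodsP[h [f' [hw fw' ->]]] gv' ->]]].
rewrite -mulrA; apply: lspanM; first exact: lspan_mem.
have := lspanM (lspan_mem gv') (wvp _ _ fw'); rewrite mulrC; apply: lspan_trans.
by move=> _ /prodsP[? [? [? ? ->]]]; apply/lspan_mem/pows_mulr.
Qed.

End InfiniteField.

(** * Boxes and chains of boxes *)

(* Variables, rows and columns are numbered from 0, so the length L i of row i is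
   lambda_(i+1); variables of index >= m are junk. *)
Definition var_mon (m i : nat) : 'X_{1..m} := if insub i is Some o then U_(o)%MM else 0%MM.

Section Boxes.
Local Open Scope nat_scope.
Variables (m n : nat) (L : nat -> nat).
Hypothesis L_noninc : forall i j, (i <= j)%N -> (j < n)%N -> (L j <= L i)%N.
Hypothesis L_le : forall i, (i < n)%N -> (L i <= m)%N.

Definition box p q := [&& p < n, p <= q & q < L p]%N.

Definition boxes : seq (nat * nat) :=
  [seq u <- [seq (p, q) | p <- iota 0 n, q <- iota 0 m] | box u.1 u.2].

Lemma mem_boxes u : (u \in boxes) = box u.1 u.2.
Proof.
rewrite mem_filter; case bu: (box _ _) => //=.
case: u bu => p q /= /and3P[pn pq qL]; apply/allpairsP; exists (p, q).
by split=> //; rewrite mem_iota //=; have := L_le pn; lia.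
Qed.

Lemma boxes_uniq : uniq boxes.
Proof.
apply/filter_uniq/allpairs_uniq; rewrite ?iota_uniq //.
by move=> [? ?] [? ?] _ _ [-> ->].
Qed.

Lemma box_bound p q : box p q -> (p < m)%N /\ (q < m)%N.
Proof. by case/and3P=> pn pq qL; have := L_le pn; lia. Qed.

(* Numbers of chains [p_1, q_1], ..., [p_N, q_N] of boxes, each contained in the
   previous one, with a <= p_1 and q_1 < e (for turns: a < p_1, and all the p_i and
   all the q_i distinct). *)
Fixpoint nested (N a e : nat) : nat :=
  if N is N'.+1 then \sum_(u <- boxes | (a <= u.1) && (u.2 < e)) nested N' u.1 u.2.+1 else 1.

Fixpoint turns (N a e : nat) : nat :=
  if N is N'.+1 then \sum_(u <- boxes | (a < u.1) && (u.2 < e)) turns N' u.1 u.2 else 1.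

Lemma box_sum_split (h : nat -> nat -> nat) a e :
  (\sum_(u <- boxes | (a <= u.1) && (u.2 < e.+1)) h u.1 u.2 =
   \sum_(u <- boxes | (a <= u.1) && (u.2 < e)) h u.1 u.2 +
   \sum_(u <- boxes | (a <= u.1) && (u.2 == e)) h u.1 u.2)%N.
Proof.
rewrite (bigID (fun u : nat * nat => (u.2 < e)%N)) /=; congr (_ + _)%N; apply: eq_bigl => u; lia.
Qed.

Lemma box_col_split (h : nat -> nat -> nat) a e : box a e ->
  (\sum_(u <- boxes | (a <= u.1) && (u.2 == e)) h u.1 u.2 =
   h a e + \sum_(u <- boxes | (a.+1 <= u.1) && (u.2 == e)) h u.1 u.2)%N.
Proof.
move=> bae; rewrite big_mkcond (bigD1_seq (a, e)) ?boxes_uniq ?mem_boxes //=.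
rewrite leqnn eqxx /=; congr (_ + _)%N; rewrite -big_mkcondr; apply: eq_bigl => -[p q] /=.
by rewrite xpair_eqE; lia.
Qed.

Lemma box_col0 (h : nat -> nat -> nat) a e : ~~ box a e ->
  (\sum_(u <- boxes | (a <= u.1) && (u.2 == e)) h u.1 u.2 = 0)%N.
Proof.
move=> bae; rewrite big_seq_cond big1 // => -[p q] /=; rewrite mem_boxes.
case/and3P=> /and3P[/= pn pq qL] ap /eqP qe; case/negP: bae.
by apply/and3P; split; have := L_noninc ap pn; lia.
Qed.

Lemma nested_diag N a : nested N.+1 a a = 0%N.
Proof.
rewrite /= big_seq_cond big1 // => -[p q]; rewrite mem_boxes /=.
by case/andP=> /and3P[]; lia.
Qed.

Lemma turns_diag N a e : (e <= a.+1)%N -> turns N.+1 a e = 0%N.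
Proof.
move=> ea; rewrite /= big_seq_cond big1 // => -[p q]; rewrite mem_boxes /=.
by case/andP=> /and3P[]; lia.
Qed.

(** The coefficient of t^N in the generating series of [g] divided by (1 - t)^c. *)
Definition hilbert_sum c N (g : nat -> nat) := (\sum_(0 <= j < N.+1) nmultisets c (N - j) * g j)%N.

Lemma hilbert_sumS c N g : hilbert_sum c.+1 N.+1 g = (hilbert_sum c N.+1 g + hilbert_sum c.+1 N g)%N.
Proof.
have top d : hilbert_sum d N.+1 g = (\sum_(0 <= j < N.+1) nmultisets d (N.+1 - j) * g j + g N.+1)%N.
  by rewrite /hilbert_sum big_nat_recr //= subnn nmultisetsx0 mul1n.
rewrite !top addnAC; congr (_ + _)%N; rewrite -big_split /=; apply: eq_big_nat => j jN.
by rewrite subSn ?nmultisetsS ?mulnDl //; lia.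
Qed.

Lemma eq_hilbert_sum c N g g' : (forall j, g j = g' j) -> hilbert_sum c N g = hilbert_sum c N g'.
Proof. by move=> e; apply: eq_bigr => j _; rewrite e. Qed.

Lemma hilbert_sumD c N g g' : hilbert_sum c N (fun j => g j + g' j)%N = (hilbert_sum c N g + hilbert_sum c N g')%N.
Proof. by rewrite -big_split; apply: eq_bigr => j _; rewrite mulnDr. Qed.

Lemma hilbert_sum_shift c N g : hilbert_sum c N.+1 (fun j => if j is j'.+1 then g j' else 0%N) = hilbert_sum c N g.
Proof. by rewrite /hilbert_sum big_nat_recl //= muln0. Qed.

(* The Hilbert series of the fibre ring is \sum_j (turns j) t^j / (1 - t)^m. *)
Lemma nested_hilbert_sum N a e : (a <= e)%N -> (a < e -> box a e.-1)%N ->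
  nested N a e = hilbert_sum (e - a) N (fun j => turns j a e).
Proof.
elim: N a e => [|N IHN] a e ae bae; first by rewrite /hilbert_sum big_nat1 nmultisetsx0.
(* Inner induction on the width: the last column is removed, and its contribution is recovered from
   the narrower interval starting at a + 1. *)
move: {2}(e - a)%N (leqnn (e - a)) => c; elim: c a e ae bae => [|c IHc] a e ae bae cle.
  have -> : e = a by lia.
  rewrite nested_diag subnn /hilbert_sum big_nat_recr // turns_diag ?leqnSn // muln0 big_nat.
  by rewrite big1 // => j /andP[_ jN]; rewrite subSn.
have [ae'|ea] := ltnP a e; last first.
  by apply: IHc => //; lia.
case: e ae bae cle ae' => // e _ bae cle ae.
have {}bae : box a e by exact: bae.
have /and3P[an _ eL] := bae.
have fE : nested N.+1 a e.+1 = (nested N.+1 a e + (nested N a e.+1 +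
    \sum_(u <- boxes | (a.+1 <= u.1) && (u.2 == e)) nested N u.1 u.2.+1))%N.
  by rewrite /= (box_sum_split (fun p q => nested N p q.+1)) (box_col_split (fun p q => nested N p q.+1)).
have gE j : turns j.+1 a e.+1 = (turns j.+1 a e +
    \sum_(u <- boxes | (a.+1 <= u.1) && (u.2 == e)) turns j u.1 u.2)%N.
  by rewrite /= (box_sum_split (turns j)).
have f1 : nested N.+1 a e = hilbert_sum (e - a) N.+1 (fun j => turns j a e).
  by apply: IHc => // [ae'|]; [apply/and3P; split; lia | lia].
rewrite fE f1 (IHN a e.+1 (leqW ae) (fun _ => bae)) subSn // hilbert_sumS.
have [b1|nb1] := boolP (box a.+1 e); last first.
  rewrite (box_col0 (fun p q => nested N p q.+1)) // addn0; congr (_ + _)%N.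
  by apply: eq_hilbert_sum => -[|j] //; rewrite gE (box_col0 (turns j)) // addn0.
have a1e : (a < e)%N by case/and3P: b1.
have f2 := IHc a.+1 e.+1 (leqW a1e) (fun _ => b1).
have f3 : nested N.+1 a.+1 e = hilbert_sum (e - a.+1) N.+1 (fun j => turns j a.+1 e).
  by apply: IHc => // [ae'|]; [case/and3P: b1 => *; apply/and3P; split; lia | lia].
have f4 : nested N.+1 a.+1 e.+1 = (nested N.+1 a.+1 e +
    \sum_(u <- boxes | (a.+1 <= u.1) && (u.2 == e)) nested N u.1 u.2.+1)%N.
  by rewrite /= (box_sum_split (fun p q => nested N p q.+1)).
have g4 j : turns j.+1 a.+1 e.+1 = (turns j.+1 a.+1 e +
    \sum_(u <- boxes | (a.+2 <= u.1) && (u.2 == e)) turns j u.1 u.2)%N.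
  by rewrite /= (box_sum_split (turns j)).
(* Inclusion-exclusion on whether the outermost box lies in row a + 1 or in column e; the last term
   counts the chains whose outermost box is [a + 1, e]. *)
have gg : hilbert_sum (e - a) N.+1 (fun j => turns j a e.+1 + turns j a.+1 e)%N =
    hilbert_sum (e - a) N.+1 (fun j => turns j a e + turns j a.+1 e.+1 +
       (if j is j'.+1 then turns j' a.+1 e else 0))%N.
  apply: eq_hilbert_sum => -[|j] //; rewrite gE g4 (box_col_split (turns j) b1); lia.
rewrite !hilbert_sumD hilbert_sum_shift in gg.
have := hilbert_sumS (e - a.+1) N (fun j => turns j a.+1 e).
rewrite -f3 -subSn // subSS => h1; rewrite subSS in f2.
have := f2 ltac:(lia); lia.
Qed.

Fixpoint nested_mon N a e : seq 'X_{1..m} :=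
  if N is N'.+1 then
    [seq (var_mon m u.1 + var_mon m u.2 + M)%MM | u <- [seq u <- boxes | (a <= u.1) && (u.2 < e)]%N,
                                    M <- nested_mon N' u.1 u.2.+1]
  else [:: 0%MM].

Lemma var_monE i (a : 'I_m) : (i < m)%N -> var_mon m i a = (i == a) :> nat.
Proof. by move=> im; rewrite /var_mon insubT /= mnm1E -val_eqE. Qed.

Lemma size_nested_mon N a e : size (nested_mon N a e) = nested N a e.
Proof.
elim: N a e => // N IHN a e.
rewrite /= size_allpairs_dep sumnE big_map big_filter; apply: eq_bigr => u _; exact: IHN.
Qed.

Lemma nested_mon_supp N a e M (i : 'I_m) : M \in nested_mon N a e ->
  M i != 0 -> (a <= i < e)%N.
Proof.
elim: N a e M => [|N IHN] a e M.
  by rewrite inE => /eqP->; rewrite mnm0E.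
case/allpairsPdep=> -[p q] [M' [/=]]; rewrite mem_filter mem_boxes /=.
case/andP=> /andP[ap qe] bpq /IHN sM' ->; have [pm qm] := box_bound bpq.
rewrite !mnmDE !var_monE // => ne; have /and3P[_ pq _] := bpq.
case: (p =P i :> nat) ne => [<-|_]; first by lia.
case: (q =P i :> nat) => [<-|_]; first by lia.
by rewrite !add0n => /sM'; lia.
Qed.

(** The endpoints of the outermost box are the smallest and the largest variable of the monomial;
    cancelling them leaves the rest of the chain. *)
Lemma nested_mon_uniq N a e : uniq (nested_mon N a e).
Proof.
elim: N a e => // N IHN a e; apply: allpairs_uniq_dep => [|u _|].
- exact/filter_uniq/boxes_uniq.
- exact: IHN.
move=> _ _ /allpairsPdep[[p q] [M [/= pb Mn ->]]] /allpairsPdep[[p' q'] [M' [/= pb' Mn' ->]]] /= E.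
move: pb; rewrite mem_filter mem_boxes => /andP[_ /= bpq].
move: pb'; rewrite mem_filter mem_boxes => /andP[_ /= bpq'].
have [pm qm] := box_bound bpq; have [pm' qm'] := box_bound bpq'.
have /and3P[_ pq _] := bpq; have /and3P[_ pq' _] := bpq'.
have Ev (i : 'I_m) : (p == i) + (q == i) + M i = (p' == i) + (q' == i) + M' i.
  by move/mnmP/(_ i): E; rewrite !mnmDE !var_monE.
have pin : (p' <= p)%N.
  have := Ev (Ordinal pm); rewrite /= eqxx; have := @nested_mon_supp _ _ _ _ (Ordinal pm) Mn'.
  by rewrite /=; case: (M' _); lia.
have pin' : (p <= p')%N.
  have := Ev (Ordinal pm'); rewrite /= eqxx; have := @nested_mon_supp _ _ _ _ (Ordinal pm') Mn.
  by rewrite /=; case: (M _); lia.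
have qin : (q <= q')%N.
  have := Ev (Ordinal qm); rewrite /= eqxx; have := @nested_mon_supp _ _ _ _ (Ordinal qm) Mn'.
  by rewrite /=; case: (M' _); lia.
have qin' : (q' <= q)%N.
  have := Ev (Ordinal qm'); rewrite /= eqxx; have := @nested_mon_supp _ _ _ _ (Ordinal qm') Mn.
  by rewrite /=; case: (M _); lia.
have ep : p = p' by lia.
have eq : q = q' by lia.
rewrite -ep -eq in E *; congr existT; exact: addmI E.
Qed.

Lemma turnsS N a e :
  turns N.+1 a e = (\sum_(u <- boxes | (a < u.1) && (u.2 < e)) turns N u.1 u.2)%N.
Proof. by []. Qed.

(** Each step inwards moves the row up and the column down by at least one. Hence the outermost box
    is long, which bounds [L i] for the rows up to its own; the later rows are handled by the inner
    chain. *)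
Lemma turns_bound N a e : turns N.+1 a e != 0%N ->
  [/\ (a + N.+1 < n)%N, (a + N.+1 + N < e)%N &
     forall i, (a < i)%N -> (i <= a + N.+1)%N -> (a + a + N.+1 + N.+1 < L i + i)%N].
Proof.
elim: N a e => [|N IHN] a e.
  rewrite turnsS sum_nat_seq_neq0.
  case/hasP=> -[p q]; rewrite mem_boxes /= => /and3P[pn pq qL] /andP[/andP[ap qe] _].
  split; [lia|lia|] => i ai ia; have -> : i = a.+1 by lia.
  have := L_noninc ap pn; lia.
rewrite turnsS sum_nat_seq_neq0.
case/hasP=> -[p q]; rewrite mem_boxes => /and3P[/= pn pq qL] /andP[/andP[/= ap qe]].
case/IHN=> pN pNq H; split; [lia|lia|] => i ai ia.
have [ip|pi] := leqP i p; first by have := L_noninc ip pn; lia.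
by have := H i pi; lia.
Qed.

(** The witness is the concentric chain of the boxes [i, 2N - i] for 1 <= i <= N, which fit exactly
    when 2N < L i + i. *)
Lemma turns_exist N : (N < n)%N ->
  (forall i, (0 < i)%N -> (i <= N)%N -> (N + N < L i + i)%N) -> turns N 0 m != 0%N.
Proof.
move=> Nn H; have key k : (k <= N)%N ->
    forall e, (N + N - (N - k) <= e)%N -> turns k (N - k) e != 0%N.
  elim: k => // k IHk kN e eN.
  rewrite turnsS sum_nat_seq_neq0.
  apply/hasP; exists (N - k, N + N - (N - k))%N => /=.
    by rewrite mem_boxes; apply/and3P; split=> /=; [lia|lia|have := H (N - k)%N; lia].
  by rewrite IHk ?(ltnW kN) // andbT; lia.
case: N Nn H key => [|N] Nn H key //.
have := key _ (leqnn _) m; rewrite subnn; apply.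
by have := H 1%N isT isT; have := @L_le 1%N (leq_ltn_trans (ltn0Sn _) Nn); lia.
Qed.

End Boxes.

(** * Straightening modulo the diagonal sums *)

Section Straightening.
Variables (m n : nat) (L : nat -> nat).
Hypothesis L_noninc : forall i j, (i <= j)%N -> (j < n)%N -> (L j <= L i)%N.
Hypothesis L_ge : forall i, (i < n)%N -> (n <= L i)%N.
Hypothesis L_le : forall i, (i < n)%N -> (L i <= m)%N.
Variables (F : fieldType) (A : comAlgType F) (x : nat -> A).

Notation box := (box n L).
Notation boxes := (boxes m n L).

Definition box_val (u : nat * nat) : A := x u.1 * x u.2.

Definition box_vals : seq A := map box_val boxes.

Definition diag_sum d : A := \sum_(0 <= i < n | (i + d < L i)%N) x i * x (i + d)%N.

Fixpoint turn_vals (N a e : nat) : seq A :=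
  if N is N'.+1 then
    [seq box_val u * M | u <- [seq u <- boxes | (a < u.1)%N && (u.2 < e)%N],
                         M <- turn_vals N' u.1 u.2]
  else [:: 1].

Lemma size_turn_vals N a e : size (turn_vals N a e) = turns m n L N a e.
Proof.
elim: N a e => // N IHN a e.
rewrite /= size_allpairs_dep sumnE big_map big_filter; apply: eq_bigr => u _; exact: IHN.
Qed.

Definition box_prod (s : seq (nat * nat)) : A := \prod_(u <- s) box_val u.

Lemma mem_box_prod s : {subset s <= boxes} -> box_prod s \in pows box_vals (size s).
Proof.
elim: s => [|u s IHs] sb; first by rewrite /box_prod big_nil inE.
rewrite /box_prod big_cons; apply: mem_prods; first by apply/map_f/sb/mem_head.
by apply: IHs => w ws; apply: sb; rewrite inE ws orbT.
Qed.

Lemma powsP N z : z \in pows box_vals N ->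
  exists s, [/\ {subset s <= boxes}, size s = N & z = box_prod s].
Proof.
elim: N z => [|N IHN] z; first by rewrite inE => /eqP->; exists [::]; rewrite /box_prod big_nil.
case/prodsP=> a [b [/mapP[u ub ->] /IHN[s [sb <- ->]] ->]]; exists (u :: s).
by split; rewrite /box_prod ?big_cons // => w /[1!inE] /predU1P[->|/sb].
Qed.

Lemma turn_vals_chain s a e : {subset s <= boxes} ->
  (forall u, u \in s -> (a < u.1)%N && (u.2 < e)%N) ->
  pairwise (fun u w : nat * nat => (u.1 < w.1)%N && (w.2 < u.2)%N) s ->
  box_prod s \in turn_vals (size s) a e.
Proof.
elim: s a e => [|u s IHs] a e sb ae /=; first by rewrite /box_prod big_nil inE.
case/andP=> /allP us ps; rewrite /box_prod big_cons.
apply/allpairsPdep; exists u, (box_prod s); split=> //.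
  by rewrite mem_filter ae ?sb ?mem_head.
by apply: IHs => // w ws; apply: sb; rewrite inE ws orbT.
Qed.

Definition energy (s : seq (nat * nat)) := (\sum_(u <- s) (u.2 - u.1) ^ 2)%N.

(** Exchanging endpoints keeps the product: the two boxes become their hull and their overlap or,
    failing an overlap, their hull and the gap [q, p']. The sum of squared lengths increases, and
    the gap is a box because p' < n <= L q. *)
Lemma uncross u w r : {subset u :: w :: r <= boxes} -> (u.1 < w.1)%N -> (u.2 < w.2)%N ->
  exists s, [/\ {subset s <= boxes}, size s = (size r).+2,
    box_prod s = box_prod [:: u, w & r] & (energy [:: u, w & r] < energy s)%N].
Proof.
case: u w => p q [p' q'] /= sb pp qq.
have : box p q by rewrite -(mem_boxes L_le (p, q)) sb ?mem_head.
have : box p' q' by rewrite -(mem_boxes L_le (p', q')) sb // !inE eqxx orbT.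
case/and3P=> pn' pq' qL' /and3P[pn pq qL]; have LL := L_noninc (ltnW pp) pn'.
have LL' (i : nat) : (i <= p')%N -> (L p' <= L i)%N by move=> ?; apply: L_noninc.
have sr t : t \in r -> t \in boxes by move=> tr; apply: sb; rewrite !inE tr !orbT.
have nq : (n <= L p')%N by apply: L_ge.
have [le|lt] := leqP q p'.
  exists [:: (p, q'), (q, p') & r]; split=> //.
  - move=> t; rewrite !inE => /or3P[/eqP->|/eqP->|/sr //]; rewrite (mem_boxes L_le);
      apply/and3P; split=> /=; try lia.
    by have := LL' _ le; lia.
  - by rewrite /box_prod !big_cons /box_val /=; ring.
  rewrite /energy !big_cons /= !addnA ltn_add2r.
  have [d e1] : exists d, q = (p + d)%N by exists (q - p)%N; lia.
  have [c e2] : exists c, p' = (q + c)%N by exists (p' - q)%N; lia.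
  have [f e3] : exists f, q' = (p' + f)%N by exists (q' - p')%N; lia.
  have -> : (q' - p = d + c + f)%N by lia.
  have -> : (p' - q = c)%N by lia.
  have -> : (q' - p' = f)%N by lia.
  have -> : (q - p = d)%N by lia.
  have : (0 < c \/ 0 < d * f)%N.
    by case: c e2 => [|c] *; [right; rewrite muln_gt0; lia | left].
  rewrite !expnS !expn0; nia.
exists [:: (p, q'), (p', q) & r]; split=> //.
- move=> t; rewrite !inE => /or3P[/eqP->|/eqP->|/sr //]; rewrite (mem_boxes L_le);
    apply/and3P; split=> /=; lia.
- by rewrite /box_prod !big_cons /box_val /=; ring.
rewrite /energy !big_cons /= !addnA ltn_add2r.
have [a e1] : exists a, p' = (p + a.+1)%N by exists (p' - p.+1)%N; lia.
have [b e2] : exists b, q' = (q + b.+1)%N by exists (q' - q.+1)%N; lia.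
have [c e3] : exists c, q = (p' + c)%N by exists (q - p')%N; lia.
have -> : (q' - p = a.+1 + c + b.+1)%N by lia.
have -> : (q - p' = c)%N by lia.
have -> : (q - p = a.+1 + c)%N by lia.
have -> : (q' - p' = c + b.+1)%N by lia.
rewrite !expnS !expn0; nia.
Qed.

Lemma energy_le s : {subset s <= boxes} -> (energy s <= size s * m ^ 2)%N.
Proof.
elim: s => [|u s IHs] sb; first by rewrite /energy big_nil.
rewrite /energy big_cons mulSn; apply: leq_add; last first.
  by apply: IHs => w ws; apply: sb; rewrite inE ws orbT.
have := sb u (mem_head _ _); rewrite (mem_boxes L_le) => /(box_bound L_le)[_ um].
by rewrite leq_exp2r //; apply: leq_trans (leq_subr _ _) (ltnW um).
Qed.

Lemma weight_le s : {subset s <= boxes} -> (\sum_(u <- s) u.1 <= size s * n)%N.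
Proof.
elim: s => [|u s IHs] sb; first by rewrite big_nil.
rewrite big_cons mulSn; apply: leq_add; last first.
  by apply: IHs => w ws; apply: sb; rewrite inE ws orbT.
by have := sb u (mem_head _ _); rewrite (mem_boxes L_le) => /and3P[/ltnW].
Qed.

(* Modulo the diagonal sums, a product of boxes in which some box u is dominated
   by another one (or starts at 0) is a combination of products of larger energy,
   or of equal energy and larger sum of row indices. *)
Lemma diag_straighten N :
  {in pows box_vals N.+1, forall z,
     lspan (prods (wlist m diag_sum) (pows box_vals N) ++ turn_vals N.+1 0 m) z}.
Proof.
set T := _ ++ _.
(* A lexicographic order in one number: the energy deficit is weighted beyond the range of the row
   sum deficit. *)
pose mu s := ((N.+1 * m ^ 2 - energy s) * (N.+1 * n).+1 + (N.+1 * n - \sum_(u <- s) u.1))%N.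
suff key k s : {subset s <= boxes} -> size s = N.+1 -> (mu s < k)%N -> lspan T (box_prod s).
  by move=> z /powsP[s [sb sN ->]]; apply: (key (mu s).+1).
elim: k s => // k IHk s sb sN muk.
have muE s' : {subset s' <= boxes} -> size s' = N.+1 -> (energy s < energy s')%N -> (mu s' < k)%N.
  move=> sb' sN' lt; apply: leq_trans (_ : mu s <= k)%N; rewrite ?ltnS // /mu.
  have := energy_le sb'; rewrite sN'; move: (N.+1 * m ^ 2)%N (N.+1 * n)%N => a b; nia.
have muW s' : {subset s' <= boxes} -> size s' = N.+1 -> energy s = energy s' ->
    (\sum_(u <- s) u.1 < \sum_(u <- s') u.1)%N -> (mu s' < k)%N.
  move=> sb' sN' e lt; apply: leq_trans (_ : mu s <= k)%N; rewrite ?ltnS // /mu e.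
  have le := weight_le sb'; rewrite sN' in le.
  by rewrite ltn_add2l; apply: ltn_sub2l => //; apply: leq_trans lt le.
have [/hasP[u us dom]|nodom] := boolP (has (fun u => (u.1 == 0)%N ||
    has (fun w => (u.1 <= w.1)%N && (u.2 <= w.2)%N) (rem u s)) s).
  pose r := rem u s; pose d := (u.2 - u.1)%N.
  have su : perm_eq s (u :: r) by apply: perm_to_rem.
  have sr : size r = N by have := perm_size su; rewrite sN => -[].
  have rb : {subset r <= boxes} by move=> w /mem_rem/sb.
  have bu : box u.1 u.2 by rewrite -(mem_boxes L_le) sb.
  have [_ um] := box_bound L_le bu; have /and3P[un uu uL] := bu.
  have ud : (u.1 + d = u.2)%N by rewrite /d; lia.
  have -> : box_prod s = diag_sum d * box_prod r -
      \sum_(i < n | (i + d < L i)%N && (i != u.1 :> nat)) box_prod ((i : nat, i + d)%N :: r).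
    rewrite /diag_sum big_mkord mulr_suml (bigD1 (Ordinal un)) /= ?ud //.
    rewrite /box_prod (perm_big _ su) /= big_cons /box_val.
    under [X in _ = _ + _ - X]eq_bigr do rewrite big_cons /box_val /=.
    by rewrite addrK.
  apply: lspanB.
    apply: lspan_mem; rewrite mem_cat mem_prods //; first by apply: wlistP; lia.
    by rewrite -sr; apply: mem_box_prod.
  apply: lspan_sum => -[i iN] /= _ /andP[iL iu].
  have ib : {subset (i, i + d)%N :: r <= boxes}.
    move=> w /[1!inE] /predU1P[->|/rb //]; rewrite (mem_boxes L_le).
    by apply/and3P; split=> //=; lia.
  have ei : energy ((i, i + d)%N :: r) = energy s.
    by rewrite /energy (perm_big _ su) /= !big_cons /= addKn.
  have [lt|] := ltnP u.1 i.
    apply: IHk => //; first by rewrite /= sr.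
    by apply: muW => //; rewrite /= ?sr // (perm_big _ su) /= !big_cons ltn_add2r.
  (* A box of the same rank in an earlier row crosses the [w] that dominates [u] strictly, so
     uncrossing gains energy. If [u] is in row 0 there is no earlier row. *)
  rewrite leq_eqVlt (negPf iu) /= => lt; have u0 : u.1 != 0%N by rewrite -lt0n; apply: leq_ltn_trans lt.
  move: dom; rewrite (negPf u0) => /hasP[w wr /andP[w1 w2]].
  have rw := perm_to_rem wr.
  have iwb : {subset [:: (i, i + d)%N, w & rem w r] <= boxes}.
    by move=> t; rewrite inE -(perm_mem rw) => tr; apply: ib; rewrite inE.
  have [|s' [sb' sz' pe' en']] := uncross iwb (leq_trans lt w1).
    by apply: leq_trans w2; rewrite -ud ltn_add2r.
  have pe : perm_eq [:: (i, i + d)%N, w & rem w r] ((i, i + d)%N :: r).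
    by rewrite perm_cons perm_sym.
  have sN' : size s' = N.+1 by rewrite sz' -sr (perm_size rw).
  have -> : box_prod ((i, i + d)%N :: r) = box_prod s'.
    by rewrite pe' /box_prod (perm_big _ pe).
  apply: IHk => //; apply: muE => //; apply: leq_trans en'.
  by rewrite -ei /energy (perm_big _ pe).
(* With no dominated box left, any two boxes are strictly nested, and sorting by rows yields a turn
   chain. *)
have strict u w r : perm_eq s [:: u, w & r] ->
    (0 < u.1)%N /\ (((u.1 < w.1) && (w.2 < u.2)) || ((w.1 < u.1) && (u.2 < w.2)))%N.
  move=> su; have us : u \in s by rewrite (perm_mem su) mem_head.
  have ws : w \in s by rewrite (perm_mem su) !inE eqxx orbT.
  have wu : w \in rem u s.
    have pr : perm_eq (rem u s) (w :: r) by rewrite -(perm_cons u) -(permPl (perm_to_rem us)).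
    by rewrite (perm_mem pr) mem_head.
  have uw : u \in rem w s.
    have pr : perm_eq (rem w s) (u :: r).
      by rewrite -(perm_cons w) -(permPl (perm_to_rem ws)) (permPl su) (perm_catCA [:: u] [:: w]).
    by rewrite (perm_mem pr) mem_head.
  have := hasPn nodom _ us; rewrite negb_or => /andP[u0 /hasPn/(_ _ wu)].
  have := hasPn nodom _ ws; rewrite negb_or => /andP[w0 /hasPn/(_ _ uw)].
  by move=> /= h h'; split; [rewrite lt0n | lia].
pose s' := sort (fun u w : nat * nat => (u.1 <= w.1)%N) s.
have ss' : perm_eq s s' by rewrite perm_sym /s' perm_sort.
have -> : box_prod s = box_prod s' by rewrite /box_prod (perm_big _ ss').
have sb' : {subset s' <= boxes} by move=> u; rewrite -(perm_mem ss'); apply: sb.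
apply: lspan_mem; rewrite mem_cat -sN (perm_size ss'); apply/orP; right.
apply: turn_vals_chain => // [u|].
  rewrite -(perm_mem ss') => us; have := hasPn nodom _ us; rewrite negb_or => /andP[u0 _].
  have := sb u us; rewrite (mem_boxes L_le) => /(box_bound L_le)[_ ->]; rewrite andbT lt0n //.
have : pairwise (fun u w : nat * nat => (u.1 <= w.1)%N) s'.
  rewrite -sorted_pairwise; last by move=> a b c /=; apply: leq_trans.
  by apply: sort_sorted => a b /=; apply: leq_total.
have : forall u w r, perm_eq s' [:: u, w & r] ->
    (((u.1 < w.1) && (w.2 < u.2)) || ((w.1 < u.1) && (u.2 < w.2)))%N.
  by move=> u w r; rewrite -(permPl ss') => /strict[].
elim: (s') => //= u t IHt st /andP[/allP ut pt]; apply/andP; split.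
  apply/allP => w wt; have := ut _ wt; have := st u w (rem w t).
  by rewrite perm_cons perm_to_rem // => /(_ isT); lia.
apply: IHt => // a b r tab; apply: (st a b (u :: r)).
rewrite -[[:: a, b, u & r]]/([:: a; b] ++ [:: u] ++ r) perm_sym perm_catCA /= perm_cons perm_sym.
exact: tab.
Qed.

End Straightening.

(** * Lower bound in the fibre *)

Section LowerBound.
Variables (K : fieldType) (Kinf : forall s : seq K, exists x : K, x \notin s).

Lemma pencil_prods (A : comAlgType K) (m : nat) (a b : nat -> A) (e ys ts : seq A) :
  {in e, forall x, lspan (prods (wlist m a) ys ++ ts) x} ->
  (forall i y, (i < m)%N -> y \in ys -> lspan e (b i * y)) ->
  exists P : {poly K}, P.[0] = 1 /\ forall t : K, P.[t] != 0 ->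
    {in e, forall x, lspan (prods (wlist m (fun i => a i + t *: b i)) ys ++ ts) x}.
Proof.
move=> ea be; pose I := ((nat * A) + A)%type.
pose ix : seq I := [seq inl _ u | u <- [seq (i, y) | i <- iota 0 m, y <- ys]] ++ [seq inr _ z | z <- ts].
pose p (u : I) := match u with inl (i, y) => a i * y | inr z => z end.
pose q (u : I) := match u with inl (i, y) => b i * y | inr z => 0 end.
have [||x|P [P0 PE]] := @lspan_pencil _ _ e (map p ix) (map q ix).
- by rewrite !size_map.
- move=> x /ea; apply: lspan_subset => z; rewrite mem_cat => /orP[|zt].
    case/prodsP=> _ [y [/mapP[i im ->] yy ->]]; apply/mapP; exists (inl (i, y)) => //.
    by rewrite mem_cat map_f //; apply/allpairsP; exists (i, y).
  by apply/mapP; exists (inr z); rewrite // mem_cat map_f ?orbT.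
- case/mapP=> -[[i y]|z] + -> /=; last by constructor.
  rewrite mem_cat => /orP[|/mapP[? _ //]].
  case/mapP=> _ /allpairsP[[i' y'] [/= im yy ->]] [-> ->].
  by apply: be => //; move: im; rewrite mem_iota.
exists P; split=> // t /PE Pt x /Pt; apply: lspan_trans => _ /mapP[[y z] + ->].
rewrite zip_map => /mapP[[[i y']|z'] + [-> ->]] /=; rewrite mem_cat => /orP[] /mapP[] //.
  move=> _ /allpairsP[[i' y''] [/= im yy ->]] [-> ->]; rewrite scalerAl -mulrDl.
  by apply: lspan_mem; rewrite mem_cat mem_prods //; apply/mapP; exists i'.
by move=> z'' zt [->]; rewrite scaler0 addr0; apply: lspan_mem; rewrite mem_cat zt orbT.
Qed.

Variables (m n : nat) (L : nat -> nat).
Hypothesis L_noninc : forall i j, (i <= j)%N -> (j < n)%N -> (L j <= L i)%N.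
Hypothesis L_ge : forall i, (i < n)%N -> (n <= L i)%N.
Hypothesis n_gt0 : (0 < n)%N.
Hypothesis L0 : L 0%N = m.

Lemma L_le i : (i < n)%N -> (L i <= m)%N.
Proof. by rewrite -L0; apply: L_noninc. Qed.

Notation R := {mpoly K[m]}.

Definition xvar i : R := 'X_[var_mon m i].

Notation v := (box_vals m n L xvar).

Lemma mem_nested_mon N a e M : M \in nested_mon m n L N a e -> 'X_[M] \in pows v N.
Proof.
elim: N a e M => [|N IHN] a e M; first by rewrite !inE => /eqP->; rewrite mpolyX0.
case/allpairsPdep=> u [M' [/= ub /IHN Mn ->]]; rewrite !mpolyXD; apply: mem_prods => //.
by apply: map_f; move: ub; rewrite mem_filter => /andP[].
Qed.

Lemma lspan_diag_sum i : lspan v (diag_sum n L xvar i).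
Proof.
apply: lspan_sum => j; rewrite mem_index_iota => /= jn jL; apply: lspan_mem.
apply/mapP; exists (j, j + i)%N => //; rewrite (mem_boxes L_le) /=.
by apply/and3P; split=> //; rewrite leq_addr.
Qed.

(* A generic member w0 + t (w - w0) of the pencil is at least as good as the
   diagonal sums w0 in every degree, and as good as w in degree r; the count of
   lspan_filtration then contradicts nested_hilbert_sum unless turns r vanishes. *)
Lemma fiber_lower_bound r s (w : nat -> R) :
  turns m n L r 0 m != 0%N -> (forall i, (i < m)%N -> lspan v (w i)) ->
  {in pows v s.+1, forall z, lspan (prods (wlist m w) (pows v s)) z} -> (r <= s)%N.
Proof.
move=> tr wv red; rewrite leqNgt; apply/negP => sr.
case: r tr sr => // r tr; rewrite ltnS => sr.
have {red sr} := pows_stab red sr; set w0 := diag_sum n L xvar => red.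
have mul (u : nat -> R) M i y : (forall i, (i < m)%N -> lspan v (u i)) -> (i < m)%N ->
    y \in pows v M -> lspan (pows v M.+1) (u i * y).
  by move=> uv im yM; apply: lspanM; [apply: uv | apply: lspan_mem].
have w0v i : (i < m)%N -> lspan v (w0 i) by move=> _; apply: lspan_diag_sum.
have /fin_all_exists[P PE] (M : 'I_r) : exists P : {poly K}, P.[0] = 1 /\
    forall t : K, P.[t] != 0 -> {in pows v M.+1, forall x,
      lspan (prods (wlist m (fun i => w0 i + t *: (w i - w0 i))) (pows v M) ++
             turn_vals m n L xvar M.+1 0 m) x}.
  apply: pencil_prods; first exact: (diag_straighten L_noninc L_ge L_le).
  by move=> i y im; apply: (mul (fun i => w i - w0 i)) => // j jm; apply: lspanB; auto.
(* The same pencil seen from its other end: w + (1 - t)(w0 - w) = w0 + t (w - w0), whence the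
   composition with 1 - X below. *)
have [||Q [Q0 QE]] := @pencil_prods _ m w (fun i => w0 i - w i) (pows v r.+1) (pows v r) [::].
- by move=> x /red; rewrite cats0.
- by move=> i y im; apply: (mul (fun i => w0 i - w i)) => // j jm; apply: lspanB; auto.
have [t] : exists t, ((\prod_M P M) * (Q \Po (1 - 'X))).[t] != 0.
  apply: (nonroot Kinf); rewrite mulf_neq0 //.
    by apply/prodf_neq0 => M _; apply: contraTneq (oner_neq0 K) => PM; rewrite -(PE M).1 PM horner0 eqxx.
  apply: contraTneq (oner_neq0 K) => /(congr1 (fun p => p.[1])).
  by rewrite horner_comp !hornerE subrr Q0 negbK => /eqP.
rewrite hornerM horner_prod mulf_eq0 negb_or horner_comp !hornerE => /andP[Pt Qt].
pose us M := pows v M.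
(* In the top degree the pencil alone generates, so the list is shorter than the Hilbert function by
   the number of turn chains of that length. *)
pose ts M := if M == r.+1 then [::] else turn_vals m n L xvar M 0 m.
have sp : {in us r.+1, forall x,
    lspan (filtration m (fun i => w0 i + t *: (w i - w0 i)) ts r.+1) x}.
  apply: lspan_filtration => [x|M Mr x xM]; first exact: lspan_mem.
  move: Mr; rewrite /us /ts eqSS ltnS leq_eqVlt => /predU1P[Mr|Mr].
    rewrite Mr eqxx; have := QE _ Qt x; rewrite -Mr => /(_ xM); congr (lspan _ _).
    congr (prods _ _ ++ _); apply: eq_map => i; rewrite -[w0 i - w i]opprB scalerN.
    by rewrite scalerBl scale1r; ring.
  rewrite (ltn_eqF Mr); apply: ((PE (Ordinal Mr)).2 t) => //.
  by move/prodf_neq0: Pt; apply.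
have := @lspan_monomials_size _ _ (nested_mon m n L r.+1 0 m)
  (filtration m (fun i => w0 i + t *: (w i - w0 i)) ts r.+1) (nested_mon_uniq L_le _ _ _).
move=> le; have {le sp} : (nested m n L r.+1 0 m <=
    size (filtration m (fun i => w0 i + t *: (w i - w0 i))%R ts r.+1))%N.
  by rewrite -size_nested_mon; apply: le => M /mem_nested_mon; apply: sp.
rewrite (nested_hilbert_sum L_noninc L_le) // => [|m0]; last first.
  by apply/and3P; split; rewrite // L0 prednK.
rewrite subn0 /hilbert_sum size_filtration big_nat_recr //= [leqRHS]big_nat_recr //=.
rewrite /ts eqxx muln0 addn0 subnn nmultisetsx0 mul1n leqNgt => /negP; apply.
rewrite (eq_big_nat _ _ (F2 := fun j => nmultisets m (r.+1 - j) * turns m n L j 0 m)%N).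
  by rewrite -addn1 leq_add2l lt0n.
by move=> j /andP[_ jr]; rewrite (ltn_eqF jr) size_turn_vals.
Qed.

End LowerBound.

(** * Ideals *)

Section IdealLemmas.
Variable R : comNzRingType.
Implicit Types (S T I J : R -> Prop) (x y z : R).

Lemma ideal_gen_ideal S : is_ideal (ideal_gen S).
Proof. by split=> *; [apply: gen_zero | apply: gen_add | apply: gen_mul]. Qed.

Lemma ideal_gen_min S I : is_ideal I -> ideal_sub S I -> ideal_sub (ideal_gen S) I.
Proof.
case=> I0 ID IM SI x; elim=> [|y /SI //|y z _ Iy _ Iz|a y _ Iy] //.
  exact: ID.
exact: IM.
Qed.

Lemma ideal_gen_sub S T : ideal_sub S (ideal_gen T) -> ideal_sub (ideal_gen S) (ideal_gen T).
Proof. by move=> ST; apply: ideal_gen_min ST; apply: ideal_gen_ideal. Qed.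

Lemma ideal_mulP I J x y : I x -> J y -> ideal_mul I J (x * y).
Proof. by move=> Ix Jy; apply: gen_base; exists x, y. Qed.

Lemma ideal_mul_mono I I' J J' : ideal_sub I I' -> ideal_sub J J' ->
  ideal_sub (ideal_mul I J) (ideal_mul I' J').
Proof.
move=> II JJ; apply: ideal_gen_sub => _ [x [y [/II Ix /JJ Jy ->]]].
exact: ideal_mulP.
Qed.

Lemma ideal_mul_gen S T U : (forall x y, S x -> T y -> ideal_gen U (x * y)) ->
  ideal_sub (ideal_mul (ideal_gen S) (ideal_gen T)) (ideal_gen U).
Proof.
move=> STU; apply: ideal_gen_sub => _ [x [y [Sx Ty ->]]].
elim: Sx => {x} [|x Sx|x x' _ IH _ IH'|a x _ IH].
- by rewrite mul0r; apply: gen_zero.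
- elim: Ty => {y} [|y Ty|y y' _ IH _ IH'|a y _ IH].
  + by rewrite mulr0; apply: gen_zero.
  + exact: STU.
  + by rewrite mulrDr; apply: gen_add.
  + by rewrite mulrCA; apply: gen_mul.
- by rewrite mulrDl; apply: gen_add.
- by rewrite -mulrA; apply: gen_mul.
Qed.

Lemma reduces_atP I J r : ideal_sub J I ->
  reduces_at J I r <-> ideal_sub (ideal_pow I r.+1) (ideal_mul J (ideal_pow I r)).
Proof.
move=> JI; split=> [H x|H x]; first by case: (H x).
by split; [apply: H | apply: ideal_mul_mono].
Qed.

Lemma reduces_atW I J r s : ideal_sub J I -> reduces_at J I r -> (r <= s)%N -> reduces_at J I s.
Proof.
move=> JI red /subnK<-; elim: (s - r)%N => // d /(reduces_atP _ JI) IH.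
apply/(reduces_atP _ JI); rewrite addSn; apply: ideal_gen_sub => _ [x [y [Ix /IH yJ ->]]].
elim: yJ => {y} [|_ [j [y [Jj Iy ->]]]|y y' _ IHy _ IHy'|a y _ IHy].
- by rewrite mulr0; apply: gen_zero.
- by rewrite mulrCA; apply: ideal_mulP => //; apply: ideal_mulP.
- by rewrite mulrDr; apply: gen_add.
- by rewrite mulrCA; apply: gen_mul.
Qed.

End IdealLemmas.

(** * Powers of a finitely generated ideal *)

Section IdealPowers.
Variables (K : fieldType) (A : comAlgType K) (v : seq A).

Lemma ideal_pow_pows N : ideal_eq (ideal_pow (ideal_gen (fun x => x \in v)) N)
                                  (ideal_gen (fun x => x \in pows v N)).
Proof.
elim: N => [|N IHN] x; split=> //=.
- by move=> _; rewrite -[x]mulr1; apply/gen_mul/gen_base; rewrite inE.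
- move=> H; have : ideal_mul (ideal_gen (fun x => x \in v)) (ideal_gen (fun x => x \in pows v N)) x.
    by apply: ideal_mul_mono H => // y /IHN.
  by apply: ideal_mul_gen => a b av bp; apply/gen_base/mem_prods.
- apply: ideal_gen_sub => _ /prodsP[a [b [av bp ->]]].
  by apply: ideal_mulP; [apply: gen_base | apply/IHN/gen_base].
Qed.

Lemma lspan_ideal (I : A -> Prop) s x : is_ideal I -> (forall y, y \in s -> I y) -> lspan s x -> I x.
Proof.
case=> I0 ID IM sI; elim=> // c y z ys _; apply: ID.
by rewrite -mulr_algl; apply/IM/sI.
Qed.

Lemma pows_reduces w J r : is_ideal J -> (forall y, y \in w -> J y) ->
  ideal_sub J (ideal_gen (fun x => x \in v)) ->
  {in pows v r.+1, forall z, lspan (prods w (pows v r)) z} ->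
  reduces_at J (ideal_gen (fun x => x \in v)) r.
Proof.
move=> idJ wJ JI red; apply/(reduces_atP _ JI) => x /ideal_pow_pows.
apply: ideal_gen_sub => z /red; apply: lspan_ideal; first exact: ideal_gen_ideal.
by move=> _ /prodsP[a [b [aw bp ->]]]; apply: ideal_mulP; [apply: wJ | apply/ideal_pow_pows/gen_base].
Qed.

End IdealPowers.

(** * Leading forms along an arc *)

(* Leading forms along the arc x_i = t^2 X_i (i < k), x_i = t X_i (k <= i < j0),
   x_i = phi x_i (j0 <= i) through the point phi.  With k = 0, j0 = m and phi the
   constant coefficient this is the lowest degree form at the origin; in general it
   is a graded quotient of the fibre of the Rees algebra at the point phi. *)
Section LeadingForms.
Variables (K E : fieldType) (m n : nat) (L : nat -> nat).
Hypothesis L_le : forall i, (i < n)%N -> (L i <= m)%N.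
Notation R := {mpoly K[m]}.
Notation B := {mpoly E[m]}.
Variables (phi : {rmorphism R -> E}) (k j0 : nat).
Notation x := (@xvar K m).
Notation X := (@xvar E m).
Hypothesis phi0 : forall i, (i < j0)%N -> phi (x i) = 0.
Hypothesis k_j0 : (k <= j0)%N.
Hypothesis L_j0 : forall i, (k <= i)%N -> (i < n)%N -> (L i <= j0)%N.

(** [E] is not presented as an extension of [K]; scalars enter it through [phi] of constant
    polynomials. *)
Definition scal (c : K) : {poly B} := ((phi c%:MP)%:MP)%:P.

Fact scal_additive : additive scal.
Proof. by move=> a b; rewrite /scal mpolyCB !rmorphB. Qed.

Fact scal_multiplicative : multiplicative scal.
Proof. by split=> [a b|]; rewrite /scal ?mpolyCM ?mpolyC1 ?rmorphM ?rmorph1. Qed.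

HB.instance Definition _ := GRing.isAdditive.Build K {poly B} scal scal_additive.
HB.instance Definition _ := GRing.isMultiplicative.Build K {poly B} scal scal_multiplicative.

Definition arc_var (i : nat) : {poly B} :=
  if (i < k)%N then 'X^2 * (X i)%:P else if (i < j0)%N then 'X * (X i)%:P else ((phi (x i))%:MP)%:P.

Definition arc : {rmorphism R -> {poly B}} := mmap scal (fun i : 'I_m => arc_var i).

Lemma arcX i : (i < m)%N -> arc (x i) = arc_var i.
Proof. by move=> im; rewrite /xvar [LHS]mmapX /var_mon insubT /= mmap1U. Qed.

Lemma arcC c : arc c%:MP = scal c. Proof. exact: mmapC. Qed.

Lemma arcXm M : arc 'X_[M] = mmap1 (fun i : 'I_m => arc_var i) M. Proof. exact: mmapX. Qed.

Lemma arc_const f : (arc f)`_0 = (phi f)%:MP.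
Proof.
elim/mpolyind: f => [|c M p _ _ IH]; first by rewrite !rmorph0 coef0.
rewrite (rmorphD arc) (rmorphD phi) coefD [X in _ + X = _]IH mpolyCD; congr (_ + _).
rewrite -mul_mpolyC (rmorphM arc) (rmorphM phi) coef0M mpolyCM; congr (_ * _).
  by rewrite arcC coefC eqxx.
rewrite arcXm mpolyXE_id (rmorph_prod phi) (rmorph_prod (@mpolyC m E)) /mmap1.
have c0p (I : Type) (r : seq I) (G : I -> {poly B}) : (\prod_(i <- r) G i)`_0 = \prod_(i <- r) (G i)`_0.
  by elim: r => [|i r IHr]; rewrite ?big_nil ?coef1 // !big_cons coef0M IHr.
rewrite c0p; apply: eq_bigr => i _.
rewrite (rmorphXn phi) (rmorphXn (@mpolyC m E)) -!horner_coef0 horner_exp horner_coef0; congr (_ ^+ _).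
have xi : 'X_i = x i by rewrite /xvar /var_mon insubT //= => im; congr 'X_[U_(_)]; apply: val_inj.
rewrite /arc_var xi; case: ifP => ik.
  by rewrite coefXnM /= phi0 ?mpolyC0 // (leq_trans ik).
by case: ifP => ij; [rewrite coefXM phi0 ?mpolyC0 | rewrite coefC].
Qed.

Definition arc_lead f : B := (arc f)`_2.

Notation v := (box_vals m n L x).
Notation I := (ideal_gen (fun z : R => z \in v)).

Definition lead_vals : seq B := map arc_lead v.

Definition has_order N f :=
  exists2 g : {poly B}, arc f = 'X^(2 * N) * g & lspan (pows lead_vals N) g`_0.

(** In a row i < k the first factor already contributes t^2; from row k on, both indices lie below
    [j0] and contribute t each. *)
Lemma box_order u : u \in boxes m n L ->
  exists2 g : {poly B}, arc (box_val x u) = 'X^2 * g & g`_0 = arc_lead (box_val x u).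
Proof.
suff H : u \in boxes m n L -> exists g, arc (box_val x u) = 'X^2 * g.
  by case/H=> g ge; exists g; rewrite // /arc_lead ge coefXnM.
rewrite (mem_boxes L_le) => bu; have [um wm] := box_bound L_le bu.
have /and3P[un uw wL] := bu.
rewrite /box_val (rmorphM arc) !arcX // /arc_var; case: ifP => uk.
  by rewrite -mulrA; eexists.
have ku : (k <= u.1)%N by rewrite leqNgt uk.
have wj : (u.2 < j0)%N by apply: leq_trans wL _; apply: L_j0.
rewrite [(u.2 < k)%N]ltnNge (leq_trans ku uw) (leq_ltn_trans uw wj) wj /=.
by exists ((X u.1)%:P * (X u.2)%:P); rewrite mulrACA -expr2.
Qed.

Lemma arc_lead_diag u : u \in boxes m n L -> (k <= u.1)%N -> arc_lead (box_val x u) = X u.1 * X u.2.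
Proof.
rewrite (mem_boxes L_le) => bu ku; have [um wm] := box_bound L_le bu.
have /and3P[un uw wL] := bu.
have wj : (u.2 < j0)%N by apply: leq_trans wL _; apply: L_j0.
rewrite /arc_lead /box_val (rmorphM arc) !arcX // /arc_var.
rewrite [(u.1 < k)%N]ltnNge ku [(u.2 < k)%N]ltnNge (leq_trans ku uw) (leq_ltn_trans uw wj) wj /=.
by rewrite mulrACA -expr2 coefXnM /= -polyCM coefC.
Qed.

Lemma arc_lead_top u : u \in boxes m n L -> (u.1 < k)%N -> (j0 <= u.2)%N ->
  arc_lead (box_val x u) = phi (x u.2) *: X u.1.
Proof.
rewrite (mem_boxes L_le) => bu ku ju; have [um wm] := box_bound L_le bu.
rewrite /arc_lead /box_val (rmorphM arc) !arcX // /arc_var ku.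
rewrite [(u.2 < k)%N]ltnNge (leq_trans k_j0 ju) [(u.2 < j0)%N]ltnNge ju /=.
by rewrite -mulrA coefXnM /= -polyCM coefC mulrC mul_mpolyC.
Qed.

Lemma pows_order N z : z \in pows v N ->
  exists2 g : {poly B}, arc z = 'X^(2 * N) * g & g`_0 \in pows lead_vals N.
Proof.
elim: N z => [|N IHN] z.
  by rewrite inE => /eqP->; exists 1; rewrite ?(rmorph1 arc) ?mulr1 // coef1 inE.
case/prodsP=> a [b [/mapP[u ub ->] /IHN[h hE h0] ->]].
have [g gE g0] := box_order ub; exists (g * h); last first.
  by rewrite coef0M; apply: mem_prods => //; rewrite g0; apply/map_f/map_f.
by rewrite (rmorphM arc) gE hE mulnS exprD mulrACA.
Qed.

Lemma pows_lead N y : y \in pows lead_vals N ->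
  exists2 z, z \in pows v N & exists2 g : {poly B}, arc z = 'X^(2 * N) * g & g`_0 = y.
Proof.
elim: N y => [|N IHN] y.
  by rewrite inE => /eqP->; exists 1; rewrite ?inE //; exists 1; rewrite ?(rmorph1 arc) ?mulr1 // coef1.
case/prodsP=> _ [b [/mapP[_ /mapP[u ub ->] ->] /IHN[z zv [h hE h0]] ->]].
exists (box_val x u * z); first by apply: mem_prods => //; apply: map_f.
have [g gE g0] := box_order ub; exists (g * h); last by rewrite coef0M g0 h0.
by rewrite (rmorphM arc) gE hE mulnS exprD mulrACA.
Qed.

(** Multiplication by [a] scales the leading coefficient by [phi a], the constant term of [arc a];
    hence closure under all of [R]. *)
Lemma order_ideal N : is_ideal (has_order N).
Proof.
split=> [|f f' [g fE gl] [g' fE' gl']|a f [g fE gl]].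
- by exists 0; rewrite ?(rmorph0 arc) ?mulr0 // coef0; constructor.
- exists (g + g'); first by rewrite (rmorphD arc) fE fE' mulrDr.
  by rewrite coefD; apply: lspanD.
- exists (arc a * g); first by rewrite (rmorphM arc) fE mulrCA.
  by rewrite coef0M arc_const mul_mpolyC; apply: lspanZ.
Qed.

Lemma ideal_pow_order N f : ideal_pow I N f -> has_order N f.
Proof.
move/ideal_pow_pows; apply: ideal_gen_min; first exact: order_ideal.
by move=> z /pows_order[g zE g0]; exists g => //; apply: lspan_mem.
Qed.

Lemma I_order f : I f -> exists2 g : {poly B}, arc f = 'X^2 * g & arc_lead f = g`_0.
Proof.
move=> If; have : ideal_pow I 1 f by rewrite -[f]mulr1; apply: ideal_mulP.
by case/ideal_pow_order=> g fE _; exists g; rewrite // /arc_lead fE coefXnM.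
Qed.

Lemma arc_leadM a f : I f -> arc_lead (a * f) = phi a *: arc_lead f.
Proof.
case/I_order=> g fE ->.
by rewrite /arc_lead (rmorphM arc) fE mulrCA coefXnM /= coef0M arc_const mul_mpolyC.
Qed.

Lemma arc_leadD f g : arc_lead (f + g) = arc_lead f + arc_lead g.
Proof. by rewrite /arc_lead (rmorphD arc) coefD. Qed.

Lemma arc_lead_lspan f : I f -> lspan lead_vals (arc_lead f).
Proof.
move=> If; have : ideal_pow I 1 f by rewrite -[f]mulr1; apply: ideal_mulP.
case/ideal_pow_order=> g fE; rewrite /arc_lead fE coefXnM; apply: lspan_subset => z.
by case/prodsP=> a [b [av /[!inE]/eqP-> ->]]; rewrite mulr1.
Qed.

(** Compare coefficients of t^(2(s+1)) when a product of s + 1 generators is written in J I^s. There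
    are finitely many such products, so finitely many elements of J suffice. *)
Lemma fiber_reduction (J : R -> Prop) s : ideal_sub J I -> reduces_at J I s ->
  exists js : seq R, (forall j, j \in js -> J j) /\
    {in pows lead_vals s.+1, forall y, lspan (prods (map arc_lead js) (pows lead_vals s)) y}.
Proof.
move=> JI /(reduces_atP _ JI) red.
have one f : ideal_mul J (ideal_pow I s) f -> exists js : seq R, (forall j, j \in js -> J j) /\
    exists2 g : {poly B}, arc f = 'X^(2 * s.+1) * g & lspan (prods (map arc_lead js) (pows lead_vals s)) g`_0.
  elim=> {f} [|_ [j [z [Jj Iz ->]]]
    |f f' _ [js [Jjs [g fE gl]]] _ [js' [Jjs' [g' fE' gl']]]|a f _ [js [Jjs [g fE gl]]]].
  - by exists [::]; split=> //; exists 0; rewrite ?(rmorph0 arc) ?mulr0 // coef0; constructor.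
  - exists [:: j]; split=> [j'|]; first by rewrite inE => /eqP->.
    have [g zE gl] := ideal_pow_order Iz; have [h jE h0] := I_order (JI _ Jj).
    exists (h * g); first by rewrite (rmorphM arc) zE jE mulnS exprD mulrACA.
    by rewrite coef0M; apply: lspanM => //; rewrite -h0; apply/lspan_mem/mem_head.
  - exists (js ++ js'); split=> [j|]; first by rewrite mem_cat => /orP[/Jjs|/Jjs'].
    exists (g + g'); first by rewrite (rmorphD arc) fE fE' mulrDr.
    rewrite coefD; apply: lspanD; [move: gl | move: gl'];
      apply: lspan_prods_mono => y ys; apply: lspan_mem => //;
      by rewrite map_cat mem_cat ys ?orbT.
  - exists js; split=> //; exists (arc a * g); first by rewrite (rmorphM arc) fE mulrCA.
    by rewrite coef0M arc_const mul_mpolyC; apply: lspanZ.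
elim: (pows lead_vals s.+1) (fun y => @pows_lead s.+1 y) => [_|y ys IH H]; first by exists [::].
have [|js [Jjs jsE]] := IH; first by move=> z zs; apply: H; rewrite inE zs orbT.
have [z zv [g zE g0]] := H y (mem_head _ _).
have [|js' [Jjs' [g' zE' g0']]] := one z.
  by apply/red/ideal_pow_pows/gen_base.
exists (js ++ js'); split=> [j|z']; first by rewrite mem_cat => /orP[/Jjs|/Jjs'].
rewrite inE => /predU1P[->|/jsE].
  have -> : y = g'`_0.
    by rewrite -g0; have := congr1 (fun q : {poly B} => q`_(2 * s.+1)) zE'; rewrite zE !coefXnM ltnn subnn.
  move: g0'; apply: lspan_prods_mono => w ws; apply: lspan_mem => //.
  by rewrite map_cat mem_cat ws orbT.
by apply: lspan_prods_mono => w ws; apply: lspan_mem => //; rewrite map_cat mem_cat ws.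
Qed.

End LeadingForms.

(** * Residue fields *)

Section ResidueField.
Local Open Scope quotient_scope.
Variable R : comNzRingType.

(** Zorn's lemma is applied to sets [A] through their union [U A] with [C], so that the empty chain
    is bounded too, its union standing for [C]. *)
Lemma maximal_ideal (C : R -> Prop) : is_ideal C -> ~ C 1 ->
  exists Q : R -> Prop, [/\ is_ideal Q, ~ Q 1, ideal_sub C Q &
    forall x, ~ Q x -> exists a, Q (1 - a * x)].
Proof.
move=> idC C1; pose U (A : R -> Prop) x := A x \/ C x.
pose P (A : R -> Prop) := is_ideal (U A) /\ ~ U A 1.
have CU A : ideal_sub C (U A) by move=> x; right.
have [|A [[idA A1] maxA]] := @classical_sets.Zorn_bigcup R P.
  move=> F FP tot.
  have up x y : U (classical_sets.bigcup F id) x -> U (classical_sets.bigcup F id) y ->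
      exists A, [/\ is_ideal (U A), U A x, U A y & forall z, U A z -> U (classical_sets.bigcup F id) z].
    have big A z : F A -> U A z -> U (classical_sets.bigcup F id) z.
      by move=> FA [Az|Cz]; [left; exists A | right].
    have idU A : F A -> is_ideal (U A) by move=> /FP[].
    case=> [[A FA Ax]|Cx] [[A' FA' Ay]|Cy].
    - have [AA|AA] := tot _ _ FA FA'.
        by exists A'; split; [exact: idU | left; apply: AA | left | move=> z; apply: big].
      by exists A; split; [exact: idU | left | left; apply: AA | move=> z; apply: big].
    - by exists A; split; [exact: idU | left | right | move=> z; apply: big].
    - by exists A'; split; [exact: idU | right | left | move=> z; apply: big].
    - exists C; split; [|by right|by right|by move=> z []; right].
      have [C0 CD CM] := idC.
      by split=> [|x' y' [] ? [] ?|a z [] ?]; left; auto.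
  split; last first.
    by case=> [[A FA A1]|//]; have [_] := FP _ FA; apply; left.
  split=> [|x y Ux Uy|a x Ux].
  - by right; case: idC.
  - by have [A [[_ AD _] Ax Ay AU]] := up x y Ux Uy; apply/AU/AD.
  - by have [A [[_ _ AM] Ax _ AU]] := up x x Ux Ux; apply/AU/AM.
have [A0 AD AM] := idA.
exists (U A); split=> // x nx.
(* If no multiple of x were 1 modulo [U A], the ideal generated by [U A] and x would be a larger
   proper one. *)
pose B z := exists a b, U A b /\ z = b + a * x.
have AB : ideal_sub (U A) B by move=> z Az; exists 0, z; rewrite mul0r addr0.
have UB z : U B z -> B z by case=> // Cz; apply/AB/CU.
have idB : is_ideal B.
  split=> [|_ _ [a [b [Ab ->]]] [a' [b' [Ab' ->]]]|c _ [a [b [Ab ->]]]].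
  - exact: AB.
  - by exists (a + a'), (b + b'); split; [apply: AD | rewrite mulrDl addrACA].
  - by exists (c * a), (c * b); split; [apply: AM | rewrite mulrDr mulrA].
apply: boolp.contrapT => noa; apply: (maxA B).
  rewrite classical_sets.properEneq; split; last by move=> z Az; apply: AB; left.
  apply/eqP => AB'; apply: nx; left; rewrite AB'; exists 1, 0.
  by split=> //; rewrite mul1r add0r.
have [B0 BD BM] := idB.
split.
  by split=> [|y z /UB By /UB Bz|a y /UB By]; left; auto.
case/UB=> a [b [Ab e]]; apply: noa; exists a.
by rewrite e addrK.
Qed.

Lemma residue_field (C : R -> Prop) : is_ideal C -> ~ C 1 ->
  exists (E : fieldType) (phi : {rmorphism R -> E}), forall x, C x -> phi x = 0.
Proof.
move=> idC C1; have [Q [[Q0 QD QM] Q1 CQ Qmax]] := maximal_ideal idC C1.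
pose q : pred R := fun x => boolp.asbool (Q x).
have qP x : reflect (Q x) (x \in q) by apply: boolp.asboolP.
have idq : idealr_closed q.
  split=> [||a x y /qP Qx /qP Qy]; apply/qP => //.
  by apply: QD => //; apply: QM.
pose qi : idealr R := HB.pack_for (idealr R) q (isIdealr.Build R q idq).
pose D : comNzRingType := {ideal_quot qi}.
pose p (x : R) : D := \pi_D x.
have p_eq x y : (p x == p y) = (x - y \in q).
  by rewrite /p -[RHS]/(x - y \in (qi : pred R)) Quotient.idealrBE.
have inv_ex (u : D) : exists y : D, (u != 0) ==> (y * u == 1).
  have [-> |u0] := eqVneq u 0; first by exists 0.
  have [|a Qa] := Qmax (repr u).
    move/qP => qu; case/eqP: u0; rewrite -[u]reprK -(rmorph0 (\pi_D : R -> D)).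
    by apply/eqP; rewrite p_eq subr0.
  exists (p a); rewrite -[u]reprK -(rmorphM (\pi_D : R -> D)) -(rmorph1 (\pi_D : R -> D)).
  by rewrite /= eq_sym p_eq; apply/qP.
have [g gP] : exists g : D -> D, forall u, (u != 0) ==> (g u * u == 1).
  by exists (fun u => xchoose (inv_ex u)) => u; apply: (xchooseP (inv_ex u)).
pose inv (u : D) : D := if u == 0 then 0 else g u.
have inv0 : inv 0 = 0 by rewrite /inv eqxx.
have mulVf u : u != 0 -> inv u * u = 1.
  by move=> u0; rewrite /inv (negPf u0); apply/eqP/(implyP (gP u)).
pose E : fieldType := HB.pack_for fieldType D (GRing.ComNzRing_isField.Build D mulVf inv0).
exists E, (\pi_D : {rmorphism R -> D}) => x Cx; apply/eqP.
rewrite -(rmorph0 (\pi_D : R -> D)).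
by have := p_eq x 0; rewrite subr0 /p => ->; apply/qP/CQ.
Qed.
End ResidueField.

(** * Minimal reductions at the origin *)

Section AtTheOrigin.
Variables (K : fieldType) (Kinf : forall s : seq K, exists x : K, x \notin s).
Variables (m n : nat) (L : nat -> nat).
Hypothesis L_le : forall i, (i < n)%N -> (L i <= m)%N.
Notation R := {mpoly K[m]}.
Notation x := (@xvar K m).
Notation v := (box_vals m n L x).
Notation I := (ideal_gen (fun z : R => z \in v)).

Definition at0 : {rmorphism R -> K} := mcoeff 0%MM.

Lemma at0_x i : (i < m)%N -> at0 (x i) = 0.
Proof.
by move=> im; rewrite /xvar [LHS]mcoeffX /var_mon insubT /= mnm1_eq0.
Qed.

Lemma at0C c : at0 c%:MP = c. Proof. exact: mpolyCK. Qed.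

Notation lead := (arc_lead at0 0 m).

Let L_m i : (0 <= i)%N -> (i < n)%N -> (L i <= m)%N. Proof. by move=> _; apply: L_le. Qed.

Lemma lead_box z : z \in v -> lead z = z.
Proof. by case/mapP=> u ub ->; apply: (arc_lead_diag L_le at0 L_m). Qed.

Lemma lead_vals0 : lead_vals n L at0 0 m = v.
Proof. by rewrite /lead_vals -[RHS]map_id; apply/eq_in_map => z /lead_box. Qed.

Let leadM a f : I f -> lead (a * f) = at0 a *: lead f.
Proof. exact: (arc_leadM L_le at0_x (leq0n m) L_m). Qed.

Let lead_v f : I f -> lspan v (lead f).
Proof. by move=> If; rewrite -lead_vals0; apply: (arc_lead_lspan L_le at0_x (leq0n m) L_m). Qed.

(** The product of I with the maximal ideal of the origin; modulo it, an element of I is determined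
    by its leading form. *)
Definition mI := ideal_gen (fun f : R => exists a b, [/\ at0 a = 0, I b & f = a * b]).

Lemma lead_remainder f : I f -> mI (f - lead f).
Proof.
elim=> {f} [|z zv|f g _ IHf _ IHg|a f If IHf].
- by rewrite /arc_lead rmorph0 coef0 subrr; constructor.
- by rewrite lead_box // subrr; constructor.
- rewrite arc_leadD opprD addrACA; exact: (gen_add IHf IHg).
rewrite (leadM a If) -mul_mpolyC.
have -> : a * f - (at0 a)%:MP * lead f = (a - (at0 a)%:MP) * f + (at0 a)%:MP * (f - lead f).
  by rewrite mulrBl mulrBr addrA subrK.
refine (gen_add _ (gen_mul _ IHf)).
by apply: gen_base; exists (a - (at0 a)%:MP), f; rewrite rmorphB at0C subrr.
Qed.

(* The elements of J whose leading form lies in the span of at most m well-chosen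
   leading forms already form a reduction, hence by minimality they exhaust J. *)
Lemma minimal_reduction_forms J : is_minimal_reduction J I ->
  exists w : seq R, [/\ (size w <= m)%N, {in w, forall z, lspan v z} &
    forall f, J f -> lspan w (lead f)].
Proof.
case=> -[idJ JI [s red]] minJ; have [J0 JD JM] := idJ.
pose good (w : seq R) := {in w, forall z, exists2 j, J j & lead j = z} /\
  exists s, {in pows v s.+1, forall z, lspan (prods w (pows v s)) z}.
have lead_span w z : {in w, forall z, exists2 j, J j & lead j = z} -> lspan w z ->
    exists2 j, J j & lead j = z.
  move=> wJ; elim=> [|c y z' yw _ [j Jj <-]]; first by exists 0; rewrite // /arc_lead rmorph0 coef0.
  have [j' Jj' <-] := wJ _ yw; exists (c%:MP * j' + j); first by apply: JD => //; apply: JM.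
  by rewrite arc_leadD leadM ?at0C //; apply: JI.
have good_v w : good w -> {in w, forall z, lspan v z}.
  by case=> wJ _ z /wJ[j /JI Ij <-]; apply: lead_v.
have [w [gw sw]] : exists w, good w /\ (size w <= m)%N.
  have [js [Jjs redjs]] := fiber_reduction L_le at0_x (leq0n m) L_m JI red.
  have : good (map lead js).
    split; last by exists s; rewrite lead_vals0 in redjs.
    by move=> _ /mapP[j /Jjs Jj ->]; exists j.
  move: (map lead js) => w; move: {2}(size w) (leqnn (size w)) => N.
  elim: N w => [|N IHN] w wN gw; first by exists w; split=> //; apply: leq_trans wN _.
  have [wm|mw] := leqP (size w) m; first by exists w.
  have [wJ [s' red']] := gw.
  have [|w' [s'' [sw' w'w redw']]] := @drop_generator K Kinf _ m x v w s' _ (good_v _ gw) red' mw.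
    move=> _ /mapP[u ub ->]; apply/lspan_mem/mem_prods.
      by apply: wlistP; move: ub; rewrite (mem_boxes L_le) => /(box_bound L_le)[].
    by apply: wlistP; move: ub; rewrite (mem_boxes L_le) => /(box_bound L_le)[].
  apply: (IHN w'); first by rewrite sw' -subn1 leq_subLR add1n.
  split; last by exists s''.
  by move=> z /w'w; apply: lead_span.
exists w; split=> //; first exact: good_v.
pose J' f := J f /\ lspan w (lead f).
have idJ' : is_ideal J'.
  split=> [|f g [Jf wf] [Jg wg]|a f [Jf wf]].
  - by split=> //; rewrite /arc_lead rmorph0 coef0; constructor.
  - by split; [exact: JD | rewrite arc_leadD; apply: lspanD].
  - by split; [exact: JM | rewrite leadM; [apply: lspanZ | apply: JI]].
have J'J : ideal_sub J' J by move=> f [].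
have J'I : ideal_sub J' I by move=> f /J'J/JI.
suff redJ' : is_reduction J' I by move=> f Jf; have [] := minJ J' idJ' J'J redJ' f Jf.
split=> //; have [wJ [s' red']] := gw; pose N := maxn s s'; exists N.
apply/(reduces_atP _ J'I).
have redN : reduces_at J I N by apply: reduces_atW red _ => //; apply: leq_maxl.
move/(reduces_atP _ JI): redN => redN.
(* An element of J times a polynomial vanishing at the origin has leading form 0, hence lies in
   [J']. With [redN], the maximal ideal of the origin times I^(N+1) falls into J' I^N. *)
have mJ' a g : at0 a = 0 -> ideal_mul J (ideal_pow I N) g -> ideal_mul J' (ideal_pow I N) (a * g).
  move=> a0; elim=> {g} [|_ [j [z [Jj Iz ->]]]|g g' _ IH _ IH'|b g _ IH].
  - by rewrite mulr0; constructor.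
  - rewrite mulrA; apply: ideal_mulP => //; split; first exact: JM.
    by rewrite leadM ?a0 ?scale0r; [constructor | apply: JI].
  - by rewrite mulrDr; apply: gen_add.
  - by rewrite mulrCA; apply: gen_mul.
have mIJ' f y : mI f -> ideal_pow I N y -> ideal_mul J' (ideal_pow I N) (f * y).
  move=> mf Iy; elim: mf => {f} [|_ [a [b [a0 Ib ->]]]|f f' _ IH _ IH'|a f _ IH].
  - by rewrite mul0r; constructor.
  - by rewrite -mulrA; apply: mJ' => //; apply: redN; apply: ideal_mulP.
  - by rewrite mulrDl; apply: gen_add.
  - by rewrite -mulrA; apply: gen_mul.
move=> f /ideal_pow_pows; apply: ideal_gen_sub => z /(pows_stab red' (leq_maxr s s')).
apply: lspan_ideal; first exact: ideal_gen_ideal.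
move=> _ /prodsP[a [y [aw yv ->]]]; have [j Jj ja] := wJ _ aw.
have Iy : ideal_pow I N y by apply/ideal_pow_pows/gen_base.
(* [a] is only the leading form of [j]; the difference lies in [mI] and is absorbed by [mIJ']. *)
have -> : a * y = j * y + - 1 * ((j - a) * y) by rewrite mulN1r mulrBl opprB addrC subrK.
apply: gen_add; first by apply: ideal_mulP => //; split; rewrite ?ja //; apply: lspan_mem.
by apply: gen_mul; apply: mIJ' => //; rewrite -ja; apply/lead_remainder/JI.
Qed.

End AtTheOrigin.

(** * The diagonal reduction at an arbitrary point *)

Lemma ideal_gen_coord (R : comNzRingType) (s : seq R) (f : R) : ideal_gen (fun z => z \in s) f ->
  exists a : nat -> R, f = \sum_(i < size s) a i * s`_i.
Proof.
elim=> {f} [|z zs|f g _ [a ->] _ [b ->]|c f _ [a ->]].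
- by exists (fun=> 0); rewrite big1 // => i _; rewrite mul0r.
- exists (fun i => (i == index z s)%:R); have lt : (index z s < size s)%N by rewrite index_mem.
  rewrite (bigD1 (Ordinal lt)) //= eqxx nth_index // mul1r big1 ?addr0 // => i.
  by rewrite -val_eqE /= => /negPf->; rewrite mul0r.
- by exists (fun i => a i + b i); rewrite -big_split; apply: eq_bigr => i _; rewrite mulrDl.
- by exists (fun i => c * a i); rewrite mulr_sumr; apply: eq_bigr => i _; rewrite mulrA.
Qed.

Lemma ideal_gen_sum (R : comNzRingType) (J : R -> Prop) (T : Type) (r : seq T) (P : pred T) (F : T -> R) :
  is_ideal J -> (forall i, P i -> J (F i)) -> J (\sum_(i <- r | P i) F i).
Proof. by case=> J0 JD JM JF; elim/big_ind: _. Qed.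

Section AtAPoint.
Variables (K E : fieldType) (m n : nat) (L : nat -> nat).
Hypothesis L_noninc : forall i j, (i <= j)%N -> (j < n)%N -> (L j <= L i)%N.
Hypothesis L_ge : forall i, (i < n)%N -> (n <= L i)%N.
Hypothesis n_gt0 : (0 < n)%N.
Hypothesis L0 : L 0%N = m.
Notation R := {mpoly K[m]}.
Notation B := {mpoly E[m]}.
Notation x := (@xvar K m).
Notation X := (@xvar E m).
Notation v := (box_vals m n L x).
Notation I := (ideal_gen (fun z : R => z \in v)).
Notation w0 := (diag_sum n L x).
Notation J0 := (ideal_gen (fun z : R => z \in wlist m w0)).

Let L_le i : (i < n)%N -> (L i <= m)%N. Proof. exact: (L_le L_noninc L0). Qed.

Lemma diag_sum_I d : I (w0 d).
Proof.
apply: lspan_ideal (lspan_diag_sum _ L_noninc L0 d); first exact: ideal_gen_ideal.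
by move=> y yv; apply: gen_base.
Qed.

Lemma diag_ideal_sub : ideal_sub J0 I.
Proof. by apply: ideal_gen_sub => _ /mapP[d _ ->]; apply: diag_sum_I. Qed.

Variable phi : {rmorphism R -> E}.
Hypothesis phi_n : forall i, (i < n)%N -> phi (x i) = 0.

(** [j0] is the first variable not vanishing at [phi], or m if all vanish; the rows i < k are those
    that reach column [j0]. *)
Let j0 := find (fun j => phi (x j) != 0) (iota 0 m).
Let k := find (fun i => L i <= j0)%N (iota 0 n).

Let n_m : (n <= m)%N. Proof. by rewrite -L0 L_ge. Qed.

Let j0_m : (j0 <= m)%N. Proof. by rewrite -[leqRHS](size_iota 0 m) find_size. Qed.

Let phi_j0 i : (i < j0)%N -> phi (x i) = 0.
Proof.
move=> ij; apply/eqP; rewrite -[_ == _]negbK; apply/negP.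
have := before_find 0%N ij; rewrite nth_iota; last exact: leq_trans ij j0_m.
by rewrite add0n => ->.
Qed.

Let phi_j0_neq0 : (j0 < m)%N -> phi (x j0) != 0.
Proof.
move=> jm; have := @nth_find _ 0%N (fun j => phi (x j) != 0) (iota 0 m).
by rewrite has_find size_iota -/j0 nth_iota // add0n; apply.
Qed.

Let n_j0 : (n <= j0)%N.
Proof.
rewrite leqNgt; apply/negP => jn; have := phi_j0_neq0 (leq_trans jn n_m).
by rewrite phi_n // eqxx.
Qed.

Let k_n : (k <= n)%N. Proof. by rewrite -[leqRHS](size_iota 0 n) find_size. Qed.

Let k_j0 : (k <= j0)%N. Proof. exact: leq_trans k_n n_j0. Qed.

Let L_gt i : (i < k)%N -> (j0 < L i)%N.
Proof.
move=> ik; have := before_find 0%N ik; rewrite nth_iota; last exact: leq_trans ik k_n.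
by rewrite add0n ltnNge => ->.
Qed.

Let L_j0 i : (k <= i)%N -> (i < n)%N -> (L i <= j0)%N.
Proof.
move=> ki iN; apply: leq_trans (L_noninc ki iN) _.
have := @nth_find _ 0%N (fun i => L i <= j0)%N (iota 0 n).
rewrite has_find size_iota -/k (leq_ltn_trans ki iN) nth_iota ?add0n; first exact.
exact: leq_ltn_trans ki iN.
Qed.

(** Row k meets the ranks d < c0, and the rows i < k are covered by the diagonals of their boxes
    [i, j0]. By [point_spread] no reduction of the fibre at [phi] has fewer than c0 + k
    generators. *)
Let c0 := if (k < n)%N then (L k - k)%N else 0%N.
Let gs : seq R := [seq w0 d | d <- iota 0 c0] ++ [seq w0 (j0 - i)%N | i <- iota 0 k].

Let size_gs : size gs = (c0 + k)%N.
Proof. by rewrite size_cat !size_map !size_iota. Qed.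

Let gs_I z : z \in gs -> I z.
Proof. by rewrite mem_cat => /orP[] /mapP[d _ ->]; apply: diag_sum_I. Qed.

(* Near the point phi, the sums along the diagonals that meet only the first k
   rows generate (x_0, ..., x_(k-1)), since x_j0 is invertible there. *)
Lemma local_generators : exists2 u : R, phi u != 0 & forall z, J0 z -> ideal_gen (fun y => y \in gs) (u * z).
Proof.
(* Row i' expresses the sum of rank j0 - i' in x_0, ..., x_(k-1): a row i >= k would need the column
   i + j0 - i' > j0, beyond its end. Cramer's rule inverts the system. *)
pose N : 'M[R]_k := \matrix_(i', i) if (i + (j0 - i') < L i)%N then x (i + (j0 - i'))%N else 0.
pose G := ideal_gen (fun y => y \in gs).
have idG : is_ideal G by apply: ideal_gen_ideal.
have rowN (i' : 'I_k) : w0 (j0 - i')%N = \sum_(i < k) N i' i * x i.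
  rewrite /diag_sum (big_cat_nat (n := k)) //= [X in _ + X]big_nat_cond [X in _ + X]big1 ?addr0.
    rewrite big_mkord big_mkcond; apply: eq_bigr => i _; rewrite mxE.
    by case: ifP => _; rewrite ?mul0r // mulrC.
  move=> i /andP[/andP[ki iN] iL]; have := L_j0 ki iN; have := ltn_ord i'; have := k_j0; lia.
have xG (i : 'I_k) : G (\det N * x i).
  have -> : \det N * x i = \sum_(i' < k) (\adj N) i i' * w0 (j0 - i')%N.
    under [RHS]eq_bigr do rewrite rowN mulr_sumr.
    rewrite exchange_big /=; under [RHS]eq_bigr do under eq_bigr do rewrite mulrA.
    under [RHS]eq_bigr do rewrite -mulr_suml.
    have adjN (j : 'I_k) : \sum_(i' < k) (\adj N) i i' * N i' j = \det N *+ (i == j).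
      by have /matrixP/(_ i j) := mul_adj_mx N; rewrite !mxE => <-; apply: eq_bigr.
    under [RHS]eq_bigr do rewrite adjN.
    by rewrite (bigD1 i) //= eqxx big1 ?addr0 // => j ji; rewrite eq_sym (negPf ji) mul0r.
  apply: ideal_gen_sum => // i' _; apply: gen_mul; apply: gen_base.
  rewrite mem_cat; apply/orP; right; apply/mapP; exists (i' : nat) => //.
  by rewrite mem_iota add0n ltn_ord.
exists (\det N).
  (* For i < i' the entry has index below [j0] and dies under [phi]: the matrix is triangular with
     [phi (x j0)] on the diagonal. *)
  rewrite -det_map_mx -det_tr det_trig; last first.
    apply/is_trig_mxP => i j ij; rewrite !mxE; case: ifP => _; rewrite ?rmorph0 // phi_j0 //.
    have := ltn_ord j; have := k_j0; lia.
  apply/prodf_neq0 => i _; rewrite !mxE; have ik := ltn_ord i.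
  have -> : (i + (j0 - i) = j0)%N by have := k_j0; lia.
  rewrite L_gt // phi_j0_neq0 //; apply: leq_trans (L_gt ik) _.
  by apply: L_le; apply: leq_trans ik k_n.
move=> z; elim=> {z} [|_ /mapP[d + ->]|y z _ Gy _ Gz|a y _ Gy].
- by rewrite mulr0; apply: gen_zero.
- rewrite mem_iota => dm; have [dc|cd] := ltnP d c0.
    apply: gen_mul; apply: gen_base; rewrite mem_cat; apply/orP; left.
    by apply: map_f; rewrite mem_iota.
  rewrite /diag_sum mulr_sumr big_nat_cond; apply: ideal_gen_sum => // i /andP[/andP[_ iN] iL].
  (* A diagonal of rank d >= c0 misses row k, hence every later row. *)
  have ik : (i < k)%N.
    rewrite ltnNge; apply/negP => ki; have := L_noninc ki iN; have kn := leq_ltn_trans ki iN.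
    by move: cd; rewrite /c0 kn; have := L_ge kn; lia.
  by rewrite mulrA mulrC; apply: gen_mul; apply: (xG (Ordinal ik)).
- by rewrite mulrDr; apply: gen_add.
- by rewrite mulrCA; apply: gen_mul.
Qed.

Notation lead := (arc_lead phi k j0).

Let leadM a f : I f -> lead (a * f) = phi a *: lead f.
Proof. exact: (arc_leadM L_le phi_j0 k_j0 L_j0). Qed.

(** The leading forms X_k X_(k+t) for t < c0, followed by X_i for i < k, each bring a variable
    absent from the earlier ones, as [spread_bound] requires. *)
Lemma point_spread (w : seq B) s :
  {in pows (lead_vals n L phi k j0) s.+1, forall z, lspan (prods w (pows (lead_vals n L phi k j0) s)) z} ->
  (size gs <= size w)%N.
Proof.
pose y t : 'X_{1..m} := if (t < c0)%N then (var_mon m k + var_mon m (k + t))%MM else var_mon m (t - c0).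
rewrite size_gs; apply: (@spread_bound _ _ _ _ y) => t tl.
  have [tc|ct] := ltnP t c0.
    have [kn kt] : (k < n)%N /\ (k + t < L k)%N.
      by move: tc; rewrite /c0; case: ifP => // kn; have := L_ge kn; lia.
    have ktm := leq_trans kt (L_le kn); have km := leq_ltn_trans (leq_addr t k) ktm.
    exists (Ordinal ktm) => [|j jt]; rewrite /y.
      by rewrite tc mnmDE !var_monE //= eqxx addn1.
    have jc := ltn_trans jt tc; rewrite jc mnmDE !var_monE //=; last by lia.
    by case: eqP => [|_]; [lia|]; case: eqP => [|_] //; lia.
  have tk : (t - c0 < k)%N by lia.
  have tm : (t - c0 < m)%N by apply: leq_trans tk (leq_trans k_n n_m).
  exists (Ordinal tm) => [|j jt]; rewrite /y.
    by rewrite ltnNge ct /= var_monE //= eqxx.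
  case: ltnP => jc.
    have [kn kt] : (k < n)%N /\ (k + j < L k)%N.
      by move: jc; rewrite /c0; case: ifP => // kn; have := L_ge kn; lia.
    have Lm := L_le kn; have km : (k + j < m)%N by lia.
    rewrite mnmDE !var_monE //=; last by lia.
    by rewrite !gtn_eqF //; lia.
  by rewrite var_monE //=; [case: eqP => [|_] //; lia | lia].
rewrite /y; case: ltnP => [tc|ct].
  have [kn kt] : (k < n)%N /\ (k + t < L k)%N.
    by move: tc; rewrite /c0; case: ifP => // kn; have := L_ge kn; lia.
  have ub : (k, k + t)%N \in boxes m n L.
    by rewrite (mem_boxes L_le); apply/and3P; split; rewrite //= leq_addr.
  rewrite mpolyXD; have := arc_lead_diag L_le phi L_j0 ub (leqnn _) => <-.
  by apply/lspan_mem/map_f/map_f.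
have tk : (t - c0 < k)%N by lia.
have tn := leq_trans tk k_n.
have ub : (t - c0, j0)%N \in boxes m n L.
  rewrite (mem_boxes L_le); apply/and3P; split; rewrite //= ?L_gt //.
  exact: leq_trans (ltnW tn) n_j0.
have := arc_lead_top L_le phi k_j0 ub tk (leqnn _) => /= le.
have xj : phi (x j0) != 0 by apply: phi_j0_neq0; apply: leq_trans (L_gt tk) (L_le tn).
rewrite -[X in lspan _ X]scale1r -(mulVf xj) -scalerA; apply: lspanZ.
rewrite -[X in lspan _ X]/(phi (x j0) *: X (t - c0)%N) -le.
by apply/lspan_mem/map_f/map_f.
Qed.

(** Near [phi], elements of [J'] are combinations of [gs]. If the coefficient matrix at [phi] has
    full column rank, a maximal minor is nonzero there and Cramer's rule puts [gs] in [J'] locally.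
    Otherwise the leading forms of [js] are spanned by fewer than [size gs] forms, against
    [point_spread]. *)
Lemma point_contradiction J' s : is_ideal J' -> ideal_sub J' J0 -> reduces_at J' I s ->
  exists2 a, phi a != 0 & forall z, J0 z -> J' (a * z).
Proof.
move=> idJ' J'J0 red; have [J'0 J'D J'M] := idJ'.
have J'I : ideal_sub J' I by move=> f /J'J0/diag_ideal_sub.
have [js [Jjs redjs]] := fiber_reduction L_le phi_j0 k_j0 L_j0 J'I red.
have [u u0 uG] := local_generators; pose l := size gs.
have /fin_all_exists[a aE] (i : 'I_(size js)) :
    exists a : nat -> R, u * js`_i = \sum_(g < l) a g * gs`_g.
  by apply/ideal_gen_coord/uG/J'J0/Jjs/mem_nth.
pose M : 'M[E]_(size js, l) := \matrix_(i, g) phi (a i g).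
have [full|nfull] := boolP (row_full M).
  pose f := fullrankfun full.
  pose N : 'M[R]_l := \matrix_(i, g) a (f i) g.
  have Nphi : map_mx phi N = rowsub f M by apply/matrixP => i g; rewrite !mxE.
  have detN : phi (\det N) != 0.
    by rewrite -det_map_mx Nphi -unitfE -unitmxE -row_full_unit /row_full /f mxrank_fullrowsub.
  have NJ (g : 'I_l) : J' (\det N * gs`_g).
    have -> : \det N * gs`_g = \sum_(i < l) (\adj N) g i * (u * js`_(f i)).
      under [RHS]eq_bigr do rewrite aE mulr_sumr.
      rewrite exchange_big /=; under [RHS]eq_bigr do under eq_bigr do rewrite mulrA.
      under [RHS]eq_bigr do rewrite -mulr_suml.
      have adjN (j : 'I_l) : \sum_(i < l) (\adj N) g i * a (f i) j = \det N *+ (g == j).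
        by have /matrixP/(_ g j) := mul_adj_mx N; rewrite !mxE => <-; apply: eq_bigr => i _; rewrite !mxE.
      under [RHS]eq_bigr do rewrite adjN.
      by rewrite (bigD1 g) //= eqxx big1 ?addr0 // => j jg; rewrite eq_sym (negPf jg) mul0r.
    by apply: ideal_gen_sum => // i _; apply/J'M/J'M/Jjs/mem_nth.
  exists (\det N * u); first by rewrite rmorphM mulf_neq0.
  move=> z /uG/ideal_gen_coord[c cE]; rewrite -mulrA cE mulr_sumr.
  by apply: ideal_gen_sum => // g _; rewrite mulrCA; apply/J'M/NJ.
pose w : seq B := [seq \sum_(g < l) row_base M i g *: lead gs`_g | i : 'I_(\rank M)].
have jw (i : 'I_(size js)) : lspan w (lead js`_i).
  have E1 : phi u *: lead js`_i = \sum_(g < l) M i g *: lead gs`_g.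
    rewrite -leadM; last by apply/J'I/Jjs/mem_nth.
    rewrite aE (big_morph lead (id1 := 0) (op1 := +%R) (@arc_leadD _ _ _ _ _ _)).
      by apply: eq_bigr => g _; rewrite leadM ?mxE //; apply/gs_I/mem_nth.
    by rewrite /arc_lead rmorph0 coef0.
  rewrite -[lead _]scale1r -(mulVf u0) -scalerA; apply: lspanZ; rewrite E1.
  have /submxP[D DE] : (row i M <= row_base M)%MS by rewrite eq_row_base row_sub.
  have -> : \sum_(g < l) M i g *: lead gs`_g =
      \sum_(r < \rank M) D 0 r *: \sum_(g < l) row_base M r g *: lead gs`_g.
    under [RHS]eq_bigr do rewrite scaler_sumr.
    rewrite exchange_big /=; apply: eq_bigr => g _.
    have MD : M i g = \sum_(r < \rank M) D 0 r * row_base M r g.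
      by have /rowP/(_ g) := DE; rewrite [LHS]mxE [RHS]mxE.
    by rewrite MD scaler_suml; apply: eq_bigr => r _; rewrite scalerA.
  apply: lspan_sum => r _ _; apply/lspanZ/lspan_mem.
  by apply/mapP; exists r; rewrite ?mem_enum.
have /point_spread : {in pows (lead_vals n L phi k j0) s.+1, forall z,
    lspan (prods w (pows (lead_vals n L phi k j0) s)) z}.
  move=> z /redjs; apply: lspan_prods_mono => y; last exact: lspan_mem.
  case/mapP=> j jjs ->; rewrite -(nth_index 0 jjs).
  have lt : (index j js < size js)%N by rewrite index_mem.
  exact: (jw (Ordinal lt)).
rewrite size_map size_enum_ord => le; case/negP: nfull.
by rewrite /row_full eqn_leq rank_leq_col.
Qed.

End AtAPoint.

(** * The reduction number *)

Section Assembly.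
Variables (K : fieldType) (Kinf : forall s : seq K, exists x : K, x \notin s).
Variables (m n : nat) (L : nat -> nat).
Hypothesis L_noninc : forall i j, (i <= j)%N -> (j < n)%N -> (L j <= L i)%N.
Hypothesis L_ge : forall i, (i < n)%N -> (n <= L i)%N.
Hypothesis n_gt0 : (0 < n)%N.
Hypothesis L0 : L 0%N = m.
Notation R := {mpoly K[m]}.
Notation x := (@xvar K m).
Notation v := (box_vals m n L x).
Notation I := (ideal_gen (fun z : R => z \in v)).
Notation w0 := (diag_sum n L x).
Notation J0 := (ideal_gen (fun z : R => z \in wlist m w0)).

Let L_m i : (i < n)%N -> (L i <= m)%N. Proof. exact: (L_le L_noninc L0). Qed.

Lemma minimal_lower_bound J r s : turns m n L r 0 m != 0%N ->
  is_minimal_reduction J I -> reduces_at J I s -> (r <= s)%N.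
Proof.
move=> tr minJ red; have [w [sw wv Jw]] := minimal_reduction_forms Kinf L_m minJ.
have [[_ JI _] _] := minJ.
have L_m' i : (0 <= i)%N -> (i < n)%N -> (L i <= m)%N by move=> _; apply: L_m.
have [js [Jjs redjs]] := fiber_reduction L_m (@at0_x K m) (leq0n m) L_m' JI red.
rewrite (lead_vals0 K L_m) in redjs.
(* The at most m forms [w] are padded with zeros to a family of m. *)
apply: (fiber_lower_bound Kinf L_noninc L_ge n_gt0 L0 (w := nth 0 w) tr) => [i im|z /redjs].
  have [lt|le] := ltnP i (size w); first by apply/wv/mem_nth.
  by rewrite nth_default //; constructor.
apply: lspan_prods_mono => y; last exact: lspan_mem.
case/mapP=> j /Jjs/Jw wj ->; apply: lspan_subset wj => z' zw.
rewrite -(nth_index 0 zw); apply: wlistP.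
by apply: leq_trans sw; rewrite index_mem.
Qed.

Lemma diag_reduction r : turns m n L r.+1 0 m = 0%N -> reduces_at J0 I r.
Proof.
move=> tr; apply: (pows_reduces (w := wlist m w0)); first exact: ideal_gen_ideal.
- by move=> y yw; refine (gen_base _).
- exact: (diag_ideal_sub L_noninc L0).
- move=> z /(diag_straighten L_noninc L_ge L_m).
  by have := size_turn_vals m n L x r.+1 0 m; rewrite tr => /size0nil->; rewrite cats0.
Qed.

(** If [J'] were smaller, the conductor [C] of [J0] into [J'] would be proper; at a residue field
    killing [C], [point_contradiction] exhibits an element of [C] that is not killed. *)
Lemma diag_minimal r : turns m n L r.+1 0 m = 0%N -> is_minimal_reduction J0 I.
Proof.
move=> tr; have J0I := diag_ideal_sub (K := K) L_noninc L0.
split; first by split; [exact: ideal_gen_ideal | exact: J0I | exists r; apply: diag_reduction].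
move=> J' idJ' J'J0 [_ J'I [s red]]; have [J'0 J'D J'M] := idJ'.
apply: boolp.contrapT => nJ'.
pose C a := forall z, J0 z -> J' (a * z).
have idC : is_ideal C.
  split=> [z _|a b Ca Cb z Jz|a b Cb z Jz]; first by rewrite mul0r.
    by rewrite mulrDl; apply: J'D; [apply: Ca | apply: Cb].
  by rewrite -mulrA; apply/J'M/Cb.
have C1 : ~ C 1 by move=> C1; apply: nJ' => z /C1; rewrite mul1r.
have [E [phi phiC]] := residue_field idC C1.
(* x_i^2 lies in I, so a power of it lies in [J'] by the reduction, and [J'] is contained in [C]. *)
have phi_n i : (i < n)%N -> phi (x i) = 0.
  move=> iN; have Iz : I (x i * x i).
    apply: gen_base; apply/mapP; exists (i, i) => //.
    by rewrite (mem_boxes L_m); apply/and3P; split=> //=; apply: leq_trans iN (L_ge iN).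
  have powI N : ideal_pow I N ((x i * x i) ^+ N).
    by elim: N => // N IHN; rewrite exprS; apply: ideal_mulP.
  have Jz : J' ((x i * x i) ^+ s.+1).
    have := (reduces_atP _ J'I).1 red _ (powI s.+1).
    apply: ideal_gen_min => // _ [a [b [Ja _ ->]]]; rewrite mulrC; exact: J'M.
  have /eqP : phi ((x i * x i) ^+ s.+1) = 0.
    by apply: phiC => z _; rewrite mulrC; apply: J'M.
  by rewrite rmorphXn rmorphM expf_eq0 mulf_eq0 orbb => /andP[_ /eqP].
have [a a0 Ca] := point_contradiction L_noninc L_ge n_gt0 L0 phi_n idJ' J'J0 red.
by case/eqP: a0; apply: phiC.
Qed.

Lemma fiber_reduction_number r : turns m n L r 0 m != 0%N -> turns m n L r.+1 0 m = 0%N ->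
  reduction_number I r.
Proof.
move=> tr tr1; have min0 := diag_minimal tr1; split; last first.
  by move=> J s minJ [red _]; apply: minimal_lower_bound tr minJ red.
exists J0; split=> //; split; first exact: diag_reduction.
by move=> s red; apply: minimal_lower_bound tr min0 red.
Qed.

End Assembly.

(** * From turn chains to the closed formula *)

Lemma leq_bigminn (j a : nat) (s : seq nat) (F : nat -> nat) :
  (j <= \big[minn/a]_(i <- s) F i)%N = (j <= a)%N && all (fun i => j <= F i)%N s.
Proof.
elim: s => [|i s IHs]; first by rewrite big_nil andbT.
by rewrite big_cons leq_min IHs /= andbCA.
Qed.

(* lam is indexed 1..n (lam i = lambda_i); values outside 1..n are irrelevant. *)
Theorem theorem6p8 (K : fieldType) (m n : nat) (lam : nat -> nat)
  (Kinf : forall s : seq K, exists x : K, x \notin s)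
  (n_pos : (1 <= n)%N)
  (lam_noninc : forall i j, (1 <= i)%N -> (i <= j)%N -> (j <= n)%N -> (lam j <= lam i)%N)
  (lam1 : lam 1%N = m)
  (lamn : (n <= lam n)%N) :
  reduction_number (@spec_ferrers_ideal K m n lam)
    (\big[minn/n.-1]_(2 <= i < n.+1) ((lam i + i)./2 - 1))%N.
Proof.
pose L i := lam i.+1.
have L_noninc i j : (i <= j)%N -> (j < n)%N -> (L j <= L i)%N.
  by move=> ij jn; apply: lam_noninc.
have L_ge i : (i < n)%N -> (n <= L i)%N.
  by move=> iN; apply: leq_trans lamn _; apply: lam_noninc.
have L_m i : (i < n)%N -> (L i <= m)%N by move=> iN; rewrite -lam1; apply: lam_noninc.
have -> : @spec_ferrers_ideal K m n lam =
    ideal_gen (fun z => z \in box_vals m n L (@xvar K m)).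
  have xE (a : 'I_m) : 'X_a = @xvar K m a.
    by rewrite /xvar /var_mon insubT //= => lt; congr 'X_[U_(_)]; apply: val_inj.
  apply: boolp.funext => z; apply: boolp.propext; split.
    apply: ideal_gen_sub => _ [a [b [an ab bL ->]]]; apply: gen_base.
    apply/mapP; exists (a : nat, b : nat); last by rewrite /box_val !xE.
    by rewrite (mem_boxes L_m); apply/and3P.
  apply: ideal_gen_sub => _ /mapP[[p q] + ->]; rewrite (mem_boxes L_m) => bpq.
  have [/= pm qm] := box_bound L_m bpq; have /and3P[pn pq qL] := bpq.
  apply: gen_base; exists (Ordinal pm), (Ordinal qm); split=> //.
  by rewrite /box_val !xE.
set r := (\big[minn/n.-1]_(2 <= i < n.+1) _)%N.
have leq_rP j : (j <= r)%N = (j <= n.-1)%N && all (fun i => j <= (lam i + i)./2 - 1)%N (index_iota 2 n.+1).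
  exact: leq_bigminn.
apply: (fiber_reduction_number Kinf L_noninc L_ge n_pos lam1).
  have := leqnn r; rewrite {1}leq_rP => /andP[rn /allP rl].
  (* With rows counted from 0, the bound on r given by row i amounts to 2r < L i + i. *)
  apply: (turns_exist L_m) => [|i i0 ir]; first by lia.
  have := rl i.+1; rewrite mem_index_iota /L => /(_ _)/implyP.
  lia.
apply/eqP; apply: contraT => /(turns_bound L_noninc L_m)[rn _ rl].
suff : (r.+1 <= r)%N by rewrite ltnn.
rewrite leq_rP; apply/andP; split; first by lia.
apply/allP => -[|i]; rewrite mem_index_iota // => /andP[i2 iN].
have [ir|ri] := leqP i r.+1; first by have := rl i; rewrite /L; lia.
(* Beyond row r + 1 the chain gives no information, but n <= L i and r + 1 < n suffice there. *)
by have := L_ge i iN; rewrite /L; lia.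
Qed.
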